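(* Consider an asymptotic regime indexed by $n\to\infty$ with $p=p_n>n$, and the linear model $Y=X\beta_0+\epsilon$, where $X=(X_1,\dots,X_p)\in\mathbb{R}^{n\times p}$ is a random design with zero mean and positive definite $\Sigma=E[X^TX/n]$, $\beta_0\in\mathbb{R}^p$ has $s_0$ nonzero entries, and $\epsilon\sim N(0,\sigma_\epsilon^2I_n)$ is independent of $X$. Assume: (A1) (general position) with probability one, for any $k<\min\{n,p\}$, any indices $i_1,\dots,i_{k+1}$ and signs $\sigma_1,\dots,\sigma_{k+1}\in\{-1,1\}$, the affine span of $\sigma_1X_{i_1},\dots,\sigma_{k+1}X_{i_{k+1}}$ contains no element of $\{\pm X_i:i\ne i_1,\dots,i_{k+1}\}$; (A2) there are positive constants $C_{\min}$, $K$ (with $n$ divisible by $K$) such that $P(\phi_{\min}(n/K)\ge C_{\min})\to1$; (A3) there is a positive constant $C_{\max}$ with $P(\phi_{\max}(n)\le C_{\max})\to1$; (A4) (i) there is a positive constant $C^*$ with $P(\phi_{\max}(1)>C^* )=O(1/p)$; (ii) there is a positive constant $\kappa_{\min}$ with $P(\kappa(s_0,3)^2\ge\kappa_{\min}^2)\to1$. Suppose $s_0=o(\sqrt{n/\log p})$. Then for suitably selected $\lambda_0\asymp\sqrt{\log p/n}$ and $\lambda_1\asymp1/\sqrt n$, $$\sqrt n(\hat b_1-\beta_{01})=W_1+\Delta_1,$$ where $W_1=\frac1{\sqrt n}\hat\Theta_1^TX^T\epsilon$ satisfies $W_1\mid X\sim N(0,\sigma_\epsilon^2\hat\Omega_{1,1})$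 with $\hat\Omega_{1,1}:=\hat\Theta_1^T\hat\Sigma\hat\Theta_1=O_P(1)$, and $\Delta_1:=\sqrt n(\hat\Sigma\hat\Theta_1-e_1)^T(\beta_0-\hat\beta)=o_P(1)$.
   Context: $\hat\Sigma=X^TX/n$; $e_1$ is the first standard basis vector; $\beta_{01}$ is the first entry of $\beta_0$. $a_n\asymp b_n$ means $C_1\le a_n/b_n\le C_2$ for positive constants $C_1,C_2$. Restricted eigenvalues: $\phi_{\max}(s)=\max_{1\le\|z\|_0\le s}\frac{\|Xz\|^2}{n\|z\|^2}$, $\phi_{\min}(s)=\min_{1\le\|z\|_0\le s}\frac{\|Xz\|^2}{n\|z\|^2}$, and $\kappa(s,c_0)^2=\min_{S\subset\{1,\dots,p\},|S|\le s}\ \min_{z\ne0,\ \|z_{S^c}\|_1\le c_0\|z_S\|_1}\frac{\|Xz\|^2}{n\|z_S\|^2}$. Lasso: $\hat\beta=\arg\min_\beta\frac1n\|Y-X\beta\|^2+2\lambda_0\|\beta\|_1$. Node-wise Lasso: $\hat\gamma_1=\arg\min_{\gamma\in\mathbb{R}^{p-1}}\frac1n\|X_1-X_{-1}\gamma\|^2+2\lambda_1\|\gamma\|_1$ ($X_{-1}$ is $X$ without its first column), $\tilde\tau_1^2=\frac1n\|X_1-X_{-1}\hat\gamma_1\|^2$, $\hat\tau_1^2=\tilde\tau_1^2+\lambda_1\|\hat\gamma_1\|_1$, $\hat\Theta_1=\hat\tau_1^{-2}(1,-\hat\gamma_1^T)^T$. Debiased Lasso: $\hat b_1=\hat\beta_1+\frac1n\hat\Theta_1^TX^T(Y-X\hat\beta)$.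 *)

(* Defs.v *)
From HB Require Import structures.
From mathcomp Require Import all_boot all_order all_algebra.
From mathcomp Require Import all_classical all_reals all_analysis.
Set Implicit Arguments. Unset Strict Implicit. Unset Printing Implicit Defensive.
Import Order.TTheory GRing.Theory Num.Theory numFieldNormedType.Exports.
Local Open Scope classical_set_scope.
Local Open Scope ring_scope.

Section deterministic.
Variable R : realType.

Definition sqnorm k (v : 'cV[R]_k) : R := \sum_i (v i 0) ^+ 2.
Definition l1norm k (v : 'cV[R]_k) : R := \sum_i `|v i 0|.
Definition l0norm k (v : 'cV[R]_k) : nat := #|[set i | v i 0 != 0]|.

Definition restrict k (S : {set 'I_k}) (z : 'cV[R]_k) : 'cV[R]_k :=
  \col_i (if i \in S then z i 0 else 0).

(** restricted eigenvalues phi_max(s), phi_min(s) (as sup / inf of the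
    Rayleigh-type quotients over s-sparse nonzero z; these are attained) *)
Definition phi_max n p (X : 'M[R]_(n, p)) (s : nat) : R :=
  sup [set sqnorm (X *m z) / (n%:R * sqnorm z) |
        z in [set z : 'cV[R]_p | (1 <= l0norm z <= s)%N]].
Definition phi_min n p (X : 'M[R]_(n, p)) (s : nat) : R :=
  inf [set sqnorm (X *m z) / (n%:R * sqnorm z) |
        z in [set z : 'cV[R]_p | (1 <= l0norm z <= s)%N]].

Definition kappa2 n p (X : 'M[R]_(n, p)) (s : nat) (c0 : R) : R :=
  inf [set r | exists (S : {set 'I_p}) (z : 'cV[R]_p),
        [/\ (#|S| <= s)%N, z != 0,
            l1norm (restrict (~: S) z) <= c0 * l1norm (restrict S z) &
            r = sqnorm (X *m z) / (n%:R * sqnorm (restrict S z))]].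

Definition general_position n p (X : 'M[R]_(n, p)) : Prop :=
  forall (k : nat) (idx : 'I_k.+1 -> 'I_p) (sg : 'I_k.+1 -> bool),
    (k < minn n p)%N -> injective idx ->
    forall (i : 'I_p) (b : bool), (forall j, idx j != i) ->
    ~ (exists c : 'I_k.+1 -> R, \sum_j c j = 1 /\
         (-1) ^+ b *: col i X = \sum_j c j *: ((-1) ^+ sg j *: col (idx j) X)).

Definition lasso_obj n p (X : 'M[R]_(n, p)) (Y : 'cV[R]_n) (lam : R)
    (b : 'cV[R]_p) : R :=
  sqnorm (Y - X *m b) / n%:R + 2 * lam * l1norm b.
Definition is_lasso_min n p (X : 'M[R]_(n, p)) (Y : 'cV[R]_n) (lam : R)
    (b : 'cV[R]_p) : Prop :=
  forall b', lasso_obj X Y lam b <= lasso_obj X Y lam b'.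

Definition is_nodewise_min n p (X : 'M[R]_(n, p.+1)) (lam : R)
    (g : 'cV[R]_p) : Prop :=
  is_lasso_min (col' ord0 X) (col ord0 X) lam g.
Definition tau_tilde2 n p (X : 'M[R]_(n, p.+1)) (g : 'cV[R]_p) : R :=
  sqnorm (col ord0 X - col' ord0 X *m g) / n%:R.
Definition tau_hat2 n p (X : 'M[R]_(n, p.+1)) (lam : R) (g : 'cV[R]_p) : R :=
  tau_tilde2 X g + lam * l1norm g.
Definition Theta1 n p (X : 'M[R]_(n, p.+1)) (lam : R) (g : 'cV[R]_p)
  : 'cV[R]_p.+1 :=
  (tau_hat2 X lam g)^-1 *:
    \col_j (match unlift ord0 j with Some k => - g k 0 | None => 1 end).

Definition Sigma_hat n p (X : 'M[R]_(n, p)) : 'M[R]_p :=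
  (n%:R)^-1 *: (X^T *m X).

Definition e1 p : 'cV[R]_p.+1 := delta_mx ord0 0.

Definition b_hat1 n p (X : 'M[R]_(n, p.+1)) (Y : 'cV[R]_n) (Th : 'cV[R]_p.+1)
    (bh : 'cV[R]_p.+1) : R :=
  bh ord0 0 + (n%:R)^-1 * ((Th^T *m X^T *m (Y - X *m bh)) 0 0).

Definition asymp (a b : nat -> R) : Prop :=
  exists C1 C2 : R, 0 < C1 /\ 0 < C2 /\ forall m, C1 <= a m / b m <= C2.

Definition gauss_law (v : R) : set R -> \bar R :=
  if v <= 0 then \d_(0 : R) else normal_prob 0 (Num.sqrt v).

End deterministic.

Section probabilistic.
Variables (R : realType) (d : measure_display) (T : measurableType d).

Definition Xevent n p (X : T -> 'M[R]_(n, p)) (A : 'I_n -> 'I_p -> set R)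
  : set T := [set w | forall i j, A i j (X w i j)].

(** the law of (X, eps): eps has iid N(0, sigma^2) entries and is independent
    of X (stated on the generating pi-system of measurable rectangles) *)
Definition gaussian_noise_indep (P : probability T R) n p
    (X : T -> 'M[R]_(n, p)) (eps : T -> 'cV[R]_n) (sigma : R) : Prop :=
  forall (A : 'I_n -> 'I_p -> set R) (B : 'I_n -> set R),
    (forall i j, measurable (A i j)) -> (forall i, measurable (B i)) ->
    fine (P (Xevent X A `&` [set w | forall i, B i (eps w i 0)])) =
    fine (P (Xevent X A)) * \prod_i fine (normal_prob 0 sigma (B i)).

(** regular conditional law of W given X is N(0, v(w)) (v a function of X):
    P({X in A} /\ {W in B}) = E[1_{X in A} N(0, v)(B)] for all rectangles A *)
Definition cond_gauss (P : probability T R) n p (X : T -> 'M[R]_(n, p))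
    (W : T -> R) (v : T -> R) : Prop :=
  forall (A : 'I_n -> 'I_p -> set R) (B : set R),
    (forall i j, measurable (A i j)) -> measurable B ->
    P (Xevent X A `&` W @^-1` B) =
    (\int[P]_(w in Xevent X A) gauss_law (v w) B)%E.

End probabilistic.

Section asymptotic.
Variables (R : realType) (d : measure_display) (T : nat -> measurableType d).
Variable (P : forall m, probability (T m) R).

(** P_m(A_m) -> 1 (via measurable subevents; = usual notion for measurable A_m) *)
Definition wp1 (A : forall m, set (T m)) : Prop :=
  exists B : forall m, set (T m),
    (forall m, measurable (B m) /\ B m `<=` A m) /\
    (fun m => fine (P m (B m))) @ \oo --> (1 : R).

Definition OP1 (Z : forall m, T m -> R) : Prop :=
  forall eta : R, 0 < eta -> exists M : R, \forall m \near \oo,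
    exists B : set (T m), [/\ measurable B, B `<=` [set w | `|Z m w| <= M] &
                             1 - eta <= fine (P m B)].

Definition oP1 (Z : forall m, T m -> R) : Prop :=
  forall delta : R, 0 < delta -> wp1 (fun m => [set w | `|Z m w| <= delta]).

Definition prob_O_inv (A : forall m, set (T m)) (p : nat -> nat) : Prop :=
  exists c : R, \forall m \near \oo,
    exists B : set (T m), [/\ measurable B, A m `<=` B &
                             fine (P m B) <= c / (p m)%:R].
End asymptotic.

(* Main.v *)
(* Writing r for the node-wise residual X_1 - X_{-1} gamma, the KKT conditions give
   |Sigma Theta - e_1|_oo <= lambda_1 / tau^2 and Omega_11 <= 1 / tau^2, where
   tau^2 = |r|^2 / n + lambda_1 |gamma|_1. With lambda_1 = 1/sqrt n, tau^2 is bounded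
   below whatever gamma is: either |gamma|_1 >= c sqrt n and the second term is at
   least c, or gamma is so small in l1 norm that, outside its n/K - 1 largest
   coordinates, its image under X is negligible (split the remainder into blocks and
   use phi_max), and phi_min bounds the rest. Hence Omega_11 = O(1), and
   |Delta_1| <= C |beta_0 - beta|_1 = O(s_0 lambda_0) = o(1) by the usual
   l1 bound for the Lasso, valid when |X^T eps|_oo / n <= lambda_0 / 2, which
   holds with high probability by the Gaussian tail bound and a union bound over the
   columns. For the conditional law of W_1, X Theta = r / tau^2 is a
   sigma(X)-measurable vector: r is determined by X and is a limit of difference
   quotients of the optimal value of the node-wise Lasso, itself an infimum over
   rational coefficient vectors. *)

Require Import Defs.
From HB Require Import structures.
From mathcomp Require Import all_boot all_order all_algebra.
From mathcomp Require Import all_classical all_reals all_analysis.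
From mathcomp Require Import measurable_realfun ring lra.
Import Order.TTheory GRing.Theory Num.Theory numFieldNormedType.Exports.
Set Implicit Arguments. Unset Strict Implicit. Unset Printing Implicit Defensive.
Local Open Scope classical_set_scope.
Local Open Scope ring_scope.

(** * Gaussian measures on the line *)

Section gaussian.
Context {R : realType}.
Notation mu := (@lebesgue_measure R).

(** The rate of lambda_1 is what lets s_0 = o(sqrt(n / log p)) suffice. In Delta_1 the factor sqrt n
    meets the bound lambda_1 / tau^2, and lambda_1 = 1/sqrt n cancels it, leaving a multiple of s_0
    sqrt(log p / n); a penalty of order sqrt(log p / n) would cost a further factor sqrt(log p). No
    sparsity of the precision matrix is assumed, so no consistency of gamma is sought. The
    conditional law meets two obstacles. Independence is given only on rectangles, while the
    variance depends on the design and may vanish: every centred Gaussian is therefore written as a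
    multiple of one fixed N(0, sigma^2) variable, which covers the degenerate case and makes
    measurability in the scale a matter of sections. Moreover the selected gamma is not known to be
    sigma(X)-measurable, so even tau^2 has to be expressed through the residual, as X_1^T r / n. *)

Lemma measurable_affine (a b : R) :
  measurable_fun [set: R] (fun x : R => a * x + b).
Proof. by apply: measurable_funD => //; exact: measurable_funM. Qed.

Lemma affine_preimage_gt0 (a b x y : R) : 0 < a ->
  (fun z => a * z + b) @^-1` `]x, y]%classic = `](x - b) / a, (y - b) / a]%classic.
Proof.
move=> a0; apply/seteqP; split => z /=; rewrite !in_itv/=;
  by rewrite ltr_pdivrMr// ler_pdivlMr// ltrBlDr lerBrDr (mulrC z).
Qed.

Lemma affine_preimage_lt0 (a b x y : R) : a < 0 ->
  (fun z => a * z + b) @^-1` `]x, y]%classic = `[(y - b) / a, (x - b) / a[%classic.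
Proof.
move=> a0; apply/seteqP; split => z /=; rewrite !in_itv/=;
  by rewrite ltr_ndivlMr// ler_ndivrMr// ltrBlDr lerBrDr (mulrC z) andbC.
Qed.

(** The image of Lebesgue measure under [x |-> a * x + b], multiplied by [|a|], agrees with Lebesgue
    measure on the intervals []x, y]], hence everywhere by uniqueness. *)
Lemma ge0_integral_affine (a b : R) (f : R -> \bar R) : a != 0 ->
  measurable_fun setT f -> (forall x, (0 <= f x)%E) ->
  (\int[mu]_x f x = `|a|%:E * \int[mu]_x f (a * x + b)%R)%E.
Proof.
move=> a0 mf f0.
have na0 : 0 <= `|a| by [].
have mg : measurable_fun setT
  (fun x : measurableTypeR R => (a * x + b : measurableTypeR R)).
  exact: measurable_affine.
pose g := fun x : measurableTypeR R => (a * x + b : measurableTypeR R).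
pose push := measure_function_pushforward__canonical__measure_function_Measure mu mg.
pose m' := mscale (NngNum na0) push.
have mE A : measurable A -> mu A = m' A.
  apply: (@lebesgue_measure_unique R m').
  move=> _ [[x y] _ <-].
  change (mu `]x, y]%classic =
    `|a|%:E * mu ((fun z : R => (a * z + b)%R) @^-1` `]x, y]%classic))%E.
  rewrite lebesgue_measure_itv/= !lte_fin.
  have [an|ap|/eqP] := ltgtP a 0; last by rewrite (negbTE a0).
    rewrite affine_preimage_lt0// lebesgue_measure_itv/= !lte_fin.
    rewrite ltr_nM2r ?invr_lt0// ltrD2r.
    case: ifPn => // _; last by rewrite mule0.
    rewrite -!EFinB -EFinM ltr0_norm//; congr EFin.
    by field.
  rewrite affine_preimage_gt0// lebesgue_measure_itv/= !lte_fin.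
  rewrite ltr_pM2r ?invr_gt0// ltrD2r.
  case: ifPn => // _; last by rewrite mule0.
  rewrite -!EFinB -EFinM gtr0_norm//; congr EFin.
  by field.
rewrite (eq_measure_integral m'); last by move=> A mA _; exact: mE.
rewrite ge0_integral_mscale//=; congr (_ * _)%E.
by rewrite [LHS](ge0_integral_pushforward mg).
Qed.



(** The normal law integrates [normal_pdf] over sets, so its Radon-Nikodym derivative is almost
    everywhere that density. *)
Lemma integral_normal_prob (m s : R) (f : R -> \bar R) :
  (normal_prob m s).-integrable setT f ->
  (\int[normal_prob m s]_x f x = \int[mu]_x (f x * (normal_pdf m s x)%:E))%E.
Proof.
move=> intf; have mf := measurable_int _ intf.
rewrite -(Radon_Nikodym_change_of_variables (normal_prob_dominates m s))//=.
apply: ae_eq_integral => //.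
- apply: emeasurable_funM => //; apply: (measurable_int mu).
  by apply: Radon_Nikodym_integrable; exact: normal_prob_dominates.
- apply: emeasurable_funM => //=; apply/measurableT_comp => //=.
  exact: measurable_normal_pdf.
- apply: ae_eqe_mul2l => /=.
  rewrite Radon_NikodymE//=; first exact: normal_prob_dominates.
  move=> dom; case: cid => /= h [h1 h2 h3].
  apply: integral_ae_eq => //=.
  + by apply/measurableT_comp => //; exact: measurable_normal_pdf.
  + by move=> E _ mE; rewrite -h3.
Qed.

Lemma ge0_integral_normal_prob_le1 (m s : R) (f : R -> \bar R) :
  measurable_fun setT f -> (forall x, (0 <= f x <= 1)%E) ->
  (\int[normal_prob m s]_x f x = \int[mu]_x (f x * (normal_pdf m s x)%:E))%E.
Proof.
move=> mf f01; apply: integral_normal_prob; apply/integrableP; split => //.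
apply: (@le_lt_trans _ _ (\int[normal_prob m s]_x cst 1 x)%E).
  apply: ge0_le_integral => //=.
  - exact: measurableT_comp.
  - by move=> x _; have /andP[f0 f1] := f01 x; rewrite gee0_abs.
by rewrite integral_cst//= mul1e probability_setT ltry.
Qed.

Lemma normal_probE_indic (m s : R) (B : set R) : measurable B ->
  (normal_prob m s B = \int[mu]_x ((\1_B x)%:E * (normal_pdf m s x)%:E))%E.
Proof.
move=> mB; rewrite /normal_prob integral_mkcond.
apply: eq_integral => x _; rewrite patchE indicE.
by case: (x \in B); rewrite ?mul1e ?mul0e.
Qed.

Lemma normal_prob_affine (m s a b : R) (B : set R) : a != 0 -> s != 0 ->
  measurable B ->
  normal_prob m s [set z | B (a * z + b)] =
  normal_prob (a * m + b) (`|a| * s) B.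
Proof.
move=> a0 s0 mB.
have mpre : measurable [set z | B (a * z + b)].
  by rewrite -[X in measurable X]setTI; exact: (measurable_affine a b).
rewrite [RHS]normal_probE_indic// (ge0_integral_affine b a0); last 2 first.
- apply: emeasurable_funM; apply/measurable_EFinP; first exact: measurable_indic.
  exact: measurable_normal_pdf.
- by move=> x; rewrite -EFinM lee_fin mulr_ge0// normal_pdf_ge0.
rewrite -ge0_integralZl//=; last 2 first.
- apply: (measurableT_comp (f := fun x => (\1_B x)%:E *
      (normal_pdf (a * m + b) (`|a| * s) x)%:E)%E); last exact: measurable_affine.
  apply: emeasurable_funM; apply/measurable_EFinP; first exact: measurable_indic.
  exact: measurable_normal_pdf.
- by move=> x _; rewrite -EFinM lee_fin mulr_ge0// normal_pdf_ge0.
rewrite normal_probE_indic//; apply: eq_integral => x _.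
rewrite muleCA -EFinM; congr (_%:E * _%:E)%E.
have as0 : `|a| * s != 0 by rewrite mulf_neq0// normr_eq0.
rewrite !normal_pdfE// mulrA; congr (_ * _).
  have -> : normal_peak (`|a| * s) = (Num.sqrt (a ^+ 2 * (s ^+ 2 * pi *+ 2)))^-1.
    by rewrite /normal_peak exprMn real_normK ?num_real//; congr (Num.sqrt _)^-1; ring.
  rewrite sqrtrM ?sqr_ge0// sqrtr_sqr invfM mulrA divff ?mul1r ?normr_eq0//.
rewrite /normal_fun exprMn real_normK ?num_real//; congr expR.
by field; rewrite s0.
Qed.

(** Tonelli, after factoring the joint density of x and y = s x + t z the other way round: the
    marginal of y times the conditional density of x given y. *)
Lemma normal_prob_convolution (sigma s t : R) (B : set R) :
  sigma != 0 -> t != 0 -> measurable B ->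
  (\int[normal_prob 0 sigma]_x normal_prob 0 sigma [set y | B (s * x + t * y)%R]
   = normal_prob 0 (Num.sqrt (s ^+ 2 + t ^+ 2) * sigma) B)%E.
Proof.
move=> sg0 t0 mB; set h := Num.sqrt _.
have h2 : h ^+ 2 = s ^+ 2 + t ^+ 2 by rewrite sqr_sqrtr// addr_ge0 ?sqr_ge0.
have h0 : 0 < h by rewrite sqrtr_gt0 ltr_wpDl ?sqr_ge0// exprn_even_gt0.
have ts0 : `|t| * sigma != 0 by rewrite mulf_neq0// normr_eq0.
pose f := fun z : R * R =>
  ((\1_B z.2)%:E * (normal_pdf (s * z.1) (`|t| * sigma) z.2)%:E)%E.
pose g := fun z : R * R => (f z * (normal_pdf 0 sigma z.1)%:E)%E.
have mf : measurable_fun setT f.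
  apply: emeasurable_funM; apply/measurable_EFinP.
    exact: (measurableT_comp (f := (\1_B : R -> R))).
  rewrite (_ : (fun z => _) = (fun z : R * R =>
     normal_pdf 0 (`|t| * sigma) (z.2 - s * z.1))); last first.
    by apply/funext => z; rewrite !normal_pdfE//= /normal_fun subr0.
  apply: (measurableT_comp (measurable_normal_pdf _ _)).
  by apply: measurable_funB => //; exact: measurable_funM.
have mg : measurable_fun setT g.
  apply: emeasurable_funM => //; apply/measurable_EFinP.
  by apply: measurableT_comp => //; exact: measurable_normal_pdf.
have f0 z : (0 <= f z)%E by rewrite /f -EFinM lee_fin mulr_ge0 ?normal_pdf_ge0.
have g0 z : (0 <= g z)%E by rewrite mule_ge0// lee_fin normal_pdf_ge0.
transitivity (\int[mu]_x \int[mu]_y g (x, y))%E.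
  under eq_integral do under eq_set do rewrite addrC.
  under eq_integral do rewrite (normal_prob_affine _ _ t0 sg0 mB) mulr0 add0r.
  rewrite ge0_integral_normal_prob_le1//=; last first.
  - by move=> x; rewrite measure_ge0 probability_le1.
  - under eq_fun do rewrite normal_probE_indic//.
    exact: (measurable_fun_fubini_tonelli_F (m2 := mu) f).
  apply: eq_integral => x _.
  rewrite normal_probE_indic// -ge0_integralZr//=; last 3 first.
  - exact: (measurableT_comp mf (measurable_pair1 x)).
  - by move=> y _; rewrite -EFinM lee_fin mulr_ge0// normal_pdf_ge0.
  - by rewrite lee_fin normal_pdf_ge0.
rewrite fubini_tonelli// normal_probE_indic//.
apply: eq_integral => y _; rewrite /g /f/=.
have p0 (x : R) : 0 <= x ^+ 2 * pi *+ 2.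
  by rewrite mulrn_wge0// mulr_ge0 ?sqr_ge0 ?pi_ge0.
have hs0 : h * sigma != 0 by rewrite mulf_neq0// gt_eqF.
have ths0 : `|t| * sigma / h != 0 by rewrite mulf_neq0// invr_eq0 gt_eqF.
(* Completing the square in x: given y, the variable x has mean y s / h^2 and standard deviation |t|
   sigma / h. This second factor integrates to 1. *)
transitivity (\int[mu]_x ((\1_B y)%:E * (normal_pdf 0 (h * sigma) y)%:E *
     (normal_pdf (y * s / h ^+ 2) (`|t| * sigma / h) x)%:E))%E.
  apply: eq_integral => x _; rewrite -!muleA; congr (_ * _)%E.
  rewrite -!EFinM; congr EFin.
  rewrite !normal_pdfE// mulrACA [RHS]mulrACA; congr (_ * _).
    rewrite /normal_peak -!invfM -!sqrtrM ?p0//.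
    congr (Num.sqrt _)^-1; rewrite !exprMn exprVn real_normK ?num_real//.
    by field; rewrite gt_eqF.
  rewrite /normal_fun -!expRD; congr expR.
  rewrite !exprMn exprVn real_normK ?num_real// h2.
  have st0 : s ^+ 2 + t ^+ 2 != 0 by rewrite -h2 expf_neq0// gt_eqF.
  by field; rewrite t0 sg0 st0.
rewrite ge0_integralZl//=.
- by rewrite integral_normal_pdf mule1.
- by apply/measurable_EFinP; exact: measurable_normal_pdf.
- by move=> x _; rewrite lee_fin normal_pdf_ge0.
- by rewrite -EFinM lee_fin mulr_ge0// normal_pdf_ge0.
Qed.



Lemma normal_prob_scale (sigma s : R) (B : set R) : sigma != 0 -> measurable B ->
  normal_prob 0 sigma [set z | B (`|s| * z)] =
  normal_prob 0 sigma [set z | B (s * z)].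
Proof.
move=> sg0 mB; have [->|s0] := eqVneq s 0; first by rewrite normr0.
have E a : a != 0 -> normal_prob 0 sigma [set z | B (a * z)] =
    normal_prob 0 (`|a| * sigma) B.
  move=> a0; under eq_set do rewrite -[_ * _]addr0.
  by rewrite (normal_prob_affine _ _ a0 sg0 mB) mulr0 addr0.
have sn0 : `|s| != 0 by rewrite normr_eq0.
by rewrite (E _ sn0) (E _ s0) normr_id.
Qed.

(** Stating the result as a rescaling of the same law, and not as a change of variance, keeps it
    meaningful when s = t = 0. For t = 0 the inner event does not depend on y, and the sign of s is
    removed by symmetry. *)
Lemma normal_prob_sum (sigma s t : R) (B : set R) : sigma != 0 -> measurable B ->
  (\int[normal_prob 0 sigma]_x normal_prob 0 sigma [set y | B (s * x + t * y)%R] =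
   normal_prob 0 sigma [set z | B (Num.sqrt (s ^+ 2 + t ^+ 2) * z)%R])%E.
Proof.
move=> sg0 mB; have [->|t0] := eqVneq t 0.
  rewrite expr0n addr0 sqrtr_sqr normal_prob_scale//.
  transitivity (\int[normal_prob 0 sigma]_x (\1_[set z | B (s * z)%R] x)%:E)%E.
    apply: eq_integral => x _; rewrite indicE.
    under eq_set do rewrite mul0r addr0.
    have [Bx|Bx] := boolP (x \in [set z | B (s * z)]).
      rewrite (_ : [set _ | _] = setT) ?probability_setT//.
      by apply/seteqP; split => // y _; rewrite inE in Bx.
    rewrite (_ : [set _ | _] = set0) ?measure0//.
    by apply/seteqP; split => // y By; move/negP: Bx; rewrite inE.
  rewrite integral_indic ?setIT//.
  by rewrite -[X in measurable X]setTI; apply: (@mulrl_measurable R setT s).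
rewrite (normal_prob_convolution _ sg0 t0 mB); set h := Num.sqrt _.
have h0 : 0 < h by rewrite sqrtr_gt0 ltr_wpDl ?sqr_ge0// exprn_even_gt0.
under eq_set do rewrite -[_ * _]addr0.
by rewrite (normal_prob_affine _ _ (lt0r_neq0 h0) sg0 mB) mulr0 addr0 gtr0_norm.
Qed.

(** Bridges the case split in [gauss_law] to the rescaling form: the Dirac branch is h = 0, where
    the preimage of B is everything or empty. *)
Lemma gauss_lawE (sigma h : R) (B : set R) : 0 < sigma -> 0 <= h -> measurable B ->
  gauss_law (sigma ^+ 2 * h ^+ 2) B = normal_prob 0 sigma [set z | B (h * z)].
Proof.
move=> sg0 h0 mB; rewrite /gauss_law.
have [->|hn0] := eqVneq h 0.
  rewrite expr0n/= mulr0 lexx diracE; under eq_set do rewrite mul0r.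
  have [B0|B0] := boolP (0 \in B).
    rewrite (_ : [set _ | _] = setT) ?probability_setT//.
    by apply/seteqP; split => // y _; rewrite inE in B0.
  rewrite (_ : [set _ | _] = set0) ?measure0//.
  by apply/seteqP; split => // y By; move/negP: B0; rewrite inE.
have hp : 0 < h by rewrite lt_def hn0.
have v0 : 0 < sigma ^+ 2 * h ^+ 2 by rewrite mulr_gt0 ?exprn_gt0.
rewrite leNgt v0 /= -exprMn sqrtr_sqr.
under [in RHS]eq_set do rewrite -[_ * _]addr0.
rewrite (normal_prob_affine _ _ hn0 (lt0r_neq0 sg0) mB) mulr0 addr0.
congr (normal_prob _ _ _); by rewrite gtr0_norm ?mulr_gt0// gtr0_norm// mulrC.
Qed.

(** For x > u one has x^2 >= u^2 + (x - u)^2, so the density is at most exp(- u^2 / (2 sigma^2))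
    times that of N(u, sigma^2), whose total mass is 1. The left tail follows by reflection. *)
Lemma normal_prob_tail (sigma u : R) : 0 < sigma -> 0 <= u ->
  (normal_prob 0 sigma [set z | (u < `|z|)%R] <=
   (2 * expR (- u ^+ 2 / (sigma ^+ 2 *+ 2)))%:E)%E.
Proof.
move=> sg0 u0; have sgn0 : sigma != 0 by rewrite gt_eqF.
have right : (normal_prob 0 sigma `]u, +oo[ <=
    (expR (- u ^+ 2 / (sigma ^+ 2 *+ 2)))%:E)%E.
  rewrite /normal_prob.
  apply: (@le_trans _ _ (\int[mu]_(x in `]u, +oo[)
      ((expR (- u ^+ 2 / (sigma ^+ 2 *+ 2)))%:E * (normal_pdf u sigma x)%:E))%E).
    apply: ge0_le_integral => //=.
    - by move=> x _; rewrite lee_fin normal_pdf_ge0.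
    - apply: measurable_funTS; apply/measurable_EFinP.
      exact: measurable_normal_pdf.
    - apply: measurable_funTS; apply: emeasurable_funM => //.
      by apply/measurable_EFinP; exact: measurable_normal_pdf.
    move=> x; rewrite in_itv/= andbT => ux.
    rewrite -EFinM lee_fin !normal_pdfE// mulrCA ler_wpM2l ?normal_peak_ge0//.
    rewrite /normal_fun -expRD ler_expR -mulrDl ler_wpM2r//.
      by rewrite invr_ge0 mulrn_wge0// sqr_ge0.
    have : 0 <= u * (x - u) by rewrite mulr_ge0// subr_ge0 ltW.
    by rewrite subr0; nra.
  rewrite ge0_integralZl//=; last 2 first.
    apply: measurable_funTS; apply/measurable_EFinP.
    exact: measurable_normal_pdf.
  - by move=> x _; rewrite lee_fin normal_pdf_ge0.
  rewrite -[leRHS]mule1; apply: lee_wpmul2l; first by rewrite lee_fin expR_ge0.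
  exact: (@probability_le1 _ _ _ (normal_prob u sigma)).
have left : normal_prob 0 sigma `]-oo, (- u)[ = normal_prob 0 sigma `]u, +oo[.
  have <- : [set z : R | `]u, +oo[%classic (-1 * z + 0)] = `]-oo, (- u)[%classic.
    apply/seteqP; split => z /=; rewrite !in_itv/= andbT mulN1r addr0.
      by rewrite ltrNr.
    by rewrite ltrNr.
  have n10 : -1 != 0 :> R by rewrite oppr_eq0 oner_eq0.
  by rewrite (normal_prob_affine _ _ n10 sgn0 (measurable_itv _)) mulr0 addr0 normrN1 mul1r.
rewrite (_ : [set z | _] = `]u, +oo[%classic `|` `]-oo, (- u)[%classic); last first.
  apply/seteqP; split => z /=; rewrite !in_itv/= andbT.
    by rewrite real_ltr_normr ?num_real// => /orP[|]; [left|right; rewrite ltrNr].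
  by rewrite real_ltr_normr ?num_real// => -[->//|]; rewrite ltrNr => ->; rewrite orbT.
apply: le_trans (measureU2 _ _ _) _ => //=.
by rewrite left mulrDl mul1r EFinD leeD.
Qed.

End gaussian.

(** * The law of a linear form in the noise, given the design *)

Lemma probability_cst d (T : measurableType d) (R : realType)
    (P : probability T R) (Q : Prop) : P [set _ | Q] = (`[<Q>]%:R)%:E.
Proof.
case: asboolP => HQ.
  rewrite -[RHS](@probability_setT _ _ _ P); congr (P _).
  by apply/seteqP; split.
by rewrite -[RHS](measure0 P); congr (P _); apply/seteqP; split.
Qed.

(** Measurable rectangles form a pi-system generating the product sigma-algebra. *)
Lemma finite_measure_rect_unique d1 d2 (T1 : measurableType d1)
    (T2 : measurableType d2) (R : realType)
    (m1 m2 : {measure set (T1 * T2) -> \bar R}) :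
  (m1 setT < +oo)%E ->
  (forall A B, measurable A -> measurable B -> m1 (A `*` B) = m2 (A `*` B)) ->
  forall H, measurable H -> m1 H = m2 H.
Proof.
move=> fin m12 H mH.
pose C : set (set (T1 * T2)) :=
  [set C | exists A, measurable A /\ exists B, measurable B /\ C = A `*` B].
apply: (measure_unique C (fun=> setT)) => //.
- rewrite measurable_prod_measurableType //; congr (<<s _ >>).
  rewrite predeqE; split => [[A mA [B mB <-]]|[A [mA [B [mB ->]]]]].
    by exists A; split => //; exists B.
  by exists A => //; exists B.
- move=> /= _ _ [X1 [mX1 [X2 [mX2 ->]]]] [Y1 [mY1 [Y2 [mY2 ->]]]].
  rewrite -setXI; exists (X1 `&` Y1); split; first exact: measurableI.
  by exists (X2 `&` Y2); split => //; exact: measurableI.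
- by move=> _; exists setT; split => //; exists setT; split => //; rewrite setXTT.
- by rewrite bigcup_const//; exists 0%N.
- by move=> A [A1 [mA1 [A2 [mA2 ->]]]]; rewrite m12.
Qed.

Section conditional_gaussian.
Context d (T : measurableType d) (R : realType) (P : probability T R).
Context (G : set (set T)) (Gm : G `<=` measurable).
Let TX := g_sigma_algebraType G.

Lemma measurable_sub_sigma : measurable_fun setT (fun w : T => (w : TX)).
Proof.
move=> _ A mA; rewrite setTI.
exact: (smallest_sub (@sigma_algebra_measurable _ T) Gm).
Qed.

(** The restriction of [P] to the sub-sigma-algebra generated by [G], obtained as its image under
    the identity; product measures with the noise law can then be formed over [TX]. *)
Definition sub_law := distribution P (mfun_Sub (mem_set measurable_sub_sigma)).


Context (GI : setI_closed G) (GT : G setT).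
Context n (eps : 'I_n -> T -> R) (meps : forall i, measurable_fun setT (eps i)).
Context (sigma : R) (sigma0 : sigma != 0).
Let RR := measurableTypeR R.
Let N : probability RR R := normal_prob 0 sigma.
Hypothesis indep : forall E (C : 'I_n -> set R), G E ->
  (forall i, measurable (C i)) ->
  P (E `&` [set w | forall i, C i (eps i w)]) =
  (fine (P E) * \prod_i fine (N (C i)))%:E.

Lemma measurable_noise_event (C : 'I_n -> set R) (p : pred 'I_n) :
  (forall i, measurable (C i)) ->
  measurable [set w | forall i, p i -> C i (eps i w)].
Proof.
move=> mC.
rewrite (_ : [set w | _] = \bigcap_(i in [set i | p i]) (eps i @^-1` C i)); last first.
  by apply/seteqP; split => w /= H i; [move=> /= pi; apply: H|apply: H].
apply: fin_bigcap_measurable => // i _.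
by rewrite -[X in measurable X]setTI; exact: meps.
Qed.

(** With the noise event fixed, both sides are finite measures in E that agree on the generating
    pi-system [G]. *)
Lemma sigma_indep (E : set TX) (C : 'I_n -> set R) : measurable E ->
  (forall i, measurable (C i)) ->
  P (E `&` [set w | forall i, C i (eps i w)]) =
  ((\prod_i fine (N (C i)))%:E * P E)%E.
Proof.
move=> mE mC; set c := \prod_i _.
have c0 : 0 <= c by apply: prodr_ge0 => i _; rewrite fine_ge0// measure_ge0.
have mD : measurable [set w | forall i, C i (eps i w)].
  have := measurable_noise_event predT mC.
  by congr measurable; apply/seteqP; split => w /= H i //; apply: H.
pose m1 := mrestr P mD.
pose m2 := mscale (NngNum c0) P.
apply: (g_sigma_algebra_measure_unique G Gm (fun=> setT) _ _ m1 m2) => //.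
- by rewrite bigcup_const//; exists 0%N.
- move=> A GA; rewrite [LHS](indep GA mC) EFinM fineK; first exact: muleC.
  by apply: fin_num_measure; exact: Gm.
- move=> k; apply: (@le_lt_trans _ _ (P setT)).
    by apply: le_measure; rewrite ?inE//; exact: measurableI.
  by rewrite ltey_eq fin_num_measure.
Qed.

Context (a : 'I_n -> TX -> R) (ma : forall i, measurable_fun setT (a i)).
Let PX : probability TX R := sub_law.
Let W k (w : T) : R := \sum_(i < n | (i < k)%N) a i w * eps i w.
Let s k (w : TX) : R := Num.sqrt (\sum_(i < n | (i < k)%N) a i w ^+ 2).

Let mW k : measurable_fun setT (W k).
Proof.
rewrite (_ : W k = fun w => \sum_(i < n) if (i < k)%N then a i w * eps i w else 0);
  last by apply/funext => w; rewrite /W big_mkcond.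
apply: measurable_sum => i; case: (_ < k)%N => //; apply: measurable_funM => //.
exact: (measurableT_comp (ma i) measurable_sub_sigma).
Qed.

Let ms k : measurable_fun setT (s k).
Proof.
apply: (measurableT_comp (continuous_measurable_fun (@sqrt_continuous R))).
rewrite (_ : (fun w => _) = fun w => \sum_(i < n) if (i < k)%N then a i w ^+ 2 else 0);
  last by apply/funext => w; rewrite big_mkcond.
by apply: measurable_sum => i; case: (_ < k)%N => //; exact: measurable_funX.
Qed.

(* The noise coordinates are absorbed one at a time: given the design, the partial
   sum [W k] has the law of [s k * Z], and adding [a k * eps k] replaces [s k] by
   [sqrt (s k ^ 2 + a k ^ 2)]. *)
Lemma gaussian_mixture k (H : set (TX * RR)) (C : 'I_n -> set R) : (k <= n)%N ->
  measurable H -> (forall i, measurable (C i)) ->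
  P [set w | H ((w : TX), W k w) /\ (forall i : 'I_n, (k <= i)%N -> C i (eps i w))] =
  ((\prod_(i < n | (k <= i)%N) fine (N (C i)))%:E *
   \int[PX]_w N [set z | H (w, s k w * z)%R])%E.
Proof.
elim: k H C => [|k IH] H C kn mH mC.
  (* No coordinate absorbed: [W 0] and [s 0] vanish, so the Gaussian degenerates to the point 0 and
     only independence remains. *)
  have -> : (fun w => N [set z | H (w, s 0 w * z)]) =
      (fun w => (\1_[set w : TX | H (w, 0)] w)%:E).
    apply/funext => w; rewrite /s big_pred0// sqrtr0 indicE.
    under eq_set do rewrite mul0r.
    rewrite (_ : (w \in _) = `[< H (w, 0) >]); last by apply/idP/asboolP; rewrite inE.
    exact: (probability_cst (normal_prob 0 sigma)).
  have mE : measurable [set w : TX | H (w, 0)].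
    rewrite -[X in measurable X]setTI.
    exact: (measurable_pair2 (0 : R) measurableT mH).
  rewrite integral_indic// setIT.
  have -> : [set w | H ((w : TX), W 0 w) /\ (forall i : 'I_n, (0 <= i)%N -> C i (eps i w))]
     = [set w : TX | H (w, 0)] `&` [set w | forall i, C i (eps i w)].
    apply/funext => w; apply/propext; rewrite /W /= big_pred0//; split.
      by move=> [Hw Cw]; split => // i; exact: Cw.
    by move=> [Hw Cw]; split => // i _; exact: Cw.
  exact: sigma_indep.
pose j := Ordinal kn.
have mD : measurable [set w | forall i : 'I_n, (k < i)%N -> C i (eps i w)].
  exact: (measurable_noise_event (fun i : 'I_n => (k < i)%N)).
set c := \prod_(i < n | _) _.
have c0 : 0 <= c by apply: prodr_ge0 => i _; rewrite fine_ge0// measure_ge0.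
pose phi : TX * RR -> TX * RR := fun z => (z.1, s k z.1 * z.2).
have mphi : measurable_fun setT phi.
  apply: measurable_fun_pair => //; apply: measurable_funM => //.
  exact: measurableT_comp.
pose mu := distribution (PX \x N)%E (mfun_Sub (mem_set mphi)).
pose psi : T -> (TX * RR) * RR := fun w => (((w : TX), W k w), eps j w).
have mpsi : measurable_fun setT psi.
  apply: (measurable_fun_pair (T2 := RR)); last exact: meps.
  apply: (measurable_fun_pair (T2 := RR)); last exact: mW.
  exact: measurable_sub_sigma.
(* [m1] is the joint law of design, [W k] and the next noise coordinate, restricted to the
   constraints on later coordinates; [m2] is its expected value, with [W k] replaced by [s k * Z]
   and an independent noise coordinate. They are compared on rectangles only. *)
pose m1 := measure_function_pushforward__canonical__measure_function_Measure
  (mrestr P mD) mpsi.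
pose m2 := mscale (NngNum c0) (mu \x N)%E.
pose H' : set ((TX * RR) * RR) := [set u | H (u.1.1, u.1.2 + a j u.1.1 * u.2)].
have mshift : measurable_fun setT (fun u : (TX * RR) * RR =>
    ((u.1.1, u.1.2 + a j u.1.1 * u.2) : TX * RR)).
  apply: (measurable_fun_pair (T2 := RR)); first exact: measurableT_comp.
  apply: (measurable_funD (R := R)); first exact: measurableT_comp.
  apply: (measurable_funM (R := R)) => //.
  by apply: measurableT_comp => //; exact: measurableT_comp.
have mH' : measurable H'.
  by rewrite -[X in measurable X]setTI; exact: mshift.
have Wk w : W k.+1 w = W k w + a j w * eps j w.
  rewrite /W (bigD1 j)//= addrC; congr (_ + _); apply: eq_bigl => i.
  by rewrite ltnS ltn_neqAle andbC.
have sk w : s k.+1 w = Num.sqrt (s k w ^+ 2 + a j w ^+ 2).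
  rewrite /s sqr_sqrtr ?sumr_ge0// => [|i _]; last exact: sqr_ge0.
  rewrite [in LHS](bigD1 j)//= addrC; congr (Num.sqrt (_ + _)).
  by apply: eq_bigl => i; rewrite ltnS ltn_neqAle andbC.
have -> : P [set w | H ((w : TX), W k.+1 w) /\
    (forall i : 'I_n, (k < i)%N -> C i (eps i w))] = m1 H'.
  rewrite /m1 /= /pushforward /mrestr; congr (P _); apply/seteqP.
  by split => w /=; rewrite /H' /= Wk.
have -> : m1 H' = m2 H'.
  refine (@finite_measure_rect_unique _ _ _ _ _ m1 m2 _ _ _ mH') => //.
    apply: (@le_lt_trans _ _ (P setT)); last by rewrite ltey_eq fin_num_measure.
    apply: le_measure; rewrite ?inE//; apply: measurableI => //.
    by rewrite -[X in measurable X]setTI; refine (mpsi _ _ _).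
  move=> F B mF mB.
  (* On a rectangle the event on coordinate k is one more noise constraint, which the induction
     hypothesis at k accepts. *)
  pose C' i := if i == j then B else C i.
  have mC' i : measurable (C' i) by rewrite /C'; case: ifP => _; [exact: mB|exact: mC].
  rewrite [RHS](_ : _ = (c%:E * (mu F * N B))%E); last first.
    by rewrite /= /m2 /mscale/= product_measure1E.
  transitivity (P [set w | F ((w : TX), W k w) /\
      (forall i : 'I_n, (k <= i)%N -> C' i (eps i w))]).
    rewrite /m1 /= /pushforward /mrestr; congr (P _); apply/seteqP.
    split => w /=; rewrite /psi /C'/=.
      move=> [[Fw Bw] Cw]; split => // i ki.
      have [->//|ij] := eqVneq i j.
      by apply: Cw; rewrite ltn_neqAle ki eq_sym andbT.
    move=> [Fw Cw]; split; first by split => //; have := Cw j; rewrite eqxx; apply.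
    move=> i ki; have := Cw i (ltnW ki); rewrite ifN//.
    by apply: contraTneq ki => ->; rewrite ltnn.
  rewrite IH//; last exact: ltnW.
  rewrite (bigD1 j)//= {1}/C' eqxx.
  rewrite (_ : \prod_(i < n | _) _ = c); last first.
    rewrite /c; apply: eq_big => [i|i /andP[_ /negPf ij]].
      by rewrite ltn_neqAle andbC eq_sym.
    by rewrite /C' ij.
  rewrite mulrC EFinM fineK ?fin_num_measure// -muleA; congr (_ * _)%E.
  rewrite muleC; congr (_ * _)%E; apply: eq_integral => w _; congr (N _).
  by apply/seteqP; split => z; rewrite /xsection/= inE.
rewrite /m2 /mscale/=; congr (_ * _)%E.
rewrite /product_measure1 ge0_integral_distribution//; last first.
  exact: measurable_fun_xsection.
rewrite fubini_tonelli1//=; last first.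
  apply: (measurableT_comp (f := N \o xsection H')) => //.
  exact: measurable_fun_xsection.
(* With the design frozen, [s k] and [a k] are constants and two independent Gaussians merge into
   one. *)
apply: eq_integral => w _; rewrite sk.
rewrite -(@normal_prob_sum _ sigma (s k w) (a j w) [set x | H (w, x)])//.
  apply: eq_integral => z _; congr (N _).
  by apply/seteqP; split => y; rewrite /xsection/= inE.
rewrite -[X in measurable X]setTI.
exact: (measurable_pair1 w measurableT mH).
Qed.

(** The mixture formula with all n coordinates absorbed, tested on [E] times [B]; the integral over
    [TX] is then carried back to [T]. *)
Lemma cond_gaussian_sum (E : set TX) (B : set R) : 0 < sigma ->
  measurable E -> measurable B ->
  P (E `&` [set w | B (\sum_i a i w * eps i w)]) =
  (\int[P]_(w in (E : set T)) gauss_law (sigma ^+ 2 * \sum_i a i w ^+ 2) B)%E.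
Proof.
move=> sg0 mE mB.
pose H : set (TX * RR) := E `*` B.
have mH : measurable H by exact: measurableX.
have Wn w : W n w = \sum_i a i w * eps i w.
  by apply: eq_bigl => i; rewrite ltn_ord.
have sn w : s n w = Num.sqrt (\sum_i a i w ^+ 2).
  by congr Num.sqrt; apply: eq_bigl => i; rewrite ltn_ord.
have -> : P (E `&` [set w | B (\sum_i a i w * eps i w)]) =
    P [set w | H ((w : TX), W n w) /\ (forall i : 'I_n, (n <= i)%N -> setT (eps i w))].
  congr (P _); apply/funext => w; apply/propext; rewrite /H /= Wn.
  by split=> [[]|[]].
rewrite [LHS](gaussian_mixture (C := fun=> setT))// big_pred0 ?mul1e; last first.
  by move=> i; rewrite leqNgt ltn_ord.
have mf : measurable_fun setT (fun w : TX => N [set z | H (w, s n w * z)]).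
  have mphi : measurable_fun setT (fun z : TX * RR => ((z.1, s n z.1 * z.2) : TX * RR)).
    apply: (measurable_fun_pair (T2 := RR)) => //; apply: (measurable_funM (R := R)) => //.
    exact: measurableT_comp.
  have mK : measurable [set z : TX * RR | H (z.1, s n z.1 * z.2)].
    by rewrite -[X in measurable X]setTI; exact: mphi.
  rewrite (_ : (fun w => _) = N \o xsection [set z : TX * RR | H (z.1, s n z.1 * z.2)]).
    exact: measurable_fun_xsection.
  by apply/funext => w; congr (N _); apply/seteqP; split => z; rewrite /xsection/= inE.
rewrite ge0_integral_distribution// [RHS]integral_mkcond.
apply: eq_integral => w _; rewrite patchE /=.
case: ifPn => wE; last first.
  rewrite -[RHS](measure0 N); congr (N _); apply/seteqP; split => // z [/= Ew _].
  by move/negP: wE; rewrite inE.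
rewrite inE in wE.
have -> : \sum_i a i w ^+ 2 = Num.sqrt (\sum_i a i w ^+ 2) ^+ 2.
  by rewrite sqr_sqrtr// sumr_ge0// => i _; rewrite sqr_ge0.
rewrite gauss_lawE ?sqrtr_ge0//; congr (N _).
by apply/seteqP; split => z /=; rewrite sn => // -[].
Qed.

End conditional_gaussian.

(** * The sigma-algebra generated by the design *)

Section design.
Context d (T : measurableType d) (R : realType) (P : probability T R) n p
  (X : T -> 'M[R]_(n, p)) (eps : T -> 'cV[R]_n) (sigma : R).
Hypothesis mX : forall i j, measurable_fun setT (fun w => X w i j).
Hypothesis meps : forall i, measurable_fun setT (fun w => eps w i 0).

(** The pi-system on which independence is assumed. It generates sigma(X), so measurability on
    [g_sigma_algebraType design_rect] means sigma(X)-measurability. *)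
Definition design_rect : set (set T) :=
  [set E | exists2 A : 'I_n -> 'I_p -> set R,
    (forall i j, measurable (A i j)) & E = Xevent X A].

Lemma design_rect_measurable : design_rect `<=` measurable.
Proof.
move=> _ [A mA ->].
rewrite (_ : Xevent X A = \bigcap_(i in [set: 'I_n]) \bigcap_(j in [set: 'I_p])
    ((fun w => X w i j) @^-1` A i j)); last first.
  by apply/seteqP; split => w H i; [move=> _ j _; exact: H|move=> j; exact: H].
apply: fin_bigcap_measurable => // i _; apply: fin_bigcap_measurable => // j _.
by rewrite -[X in measurable X]setTI; exact: mX.
Qed.

Lemma design_rectI : setI_closed design_rect.
Proof.
move=> _ _ [A mA ->] [B mB ->]; exists (fun i j => A i j `&` B i j).
  by move=> i j; exact: measurableI.
apply/seteqP; split => w /=; first by move=> [HA HB] i j; split.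
by move=> H; split => i j; have [] := H i j.
Qed.

Lemma design_rectT : design_rect setT.
Proof. by exists (fun _ _ => setT) => //; apply/seteqP; split. Qed.

Lemma measurable_design_entry i j :
  measurable_fun setT (fun w : g_sigma_algebraType design_rect => X w i j).
Proof.
move=> _ B mB; rewrite setTI; apply: sub_sigma_algebra.
exists (fun i' j' => if (i' == i) && (j' == j) then B else setT).
  by move=> i' j'; case: ifP.
apply/seteqP; split => w /=; first by move=> Bw i' j'; case: ifP => // /andP[/eqP-> /eqP->].
by move=> /(_ i j); rewrite !eqxx.
Qed.

Lemma design_rect_sigma_measurable (E : set (g_sigma_algebraType design_rect)) :
  measurable E -> measurable (E : set T).
Proof. exact: (smallest_sub (@sigma_algebra_measurable _ T) design_rect_measurable). Qed.

Hypothesis gauss : gaussian_noise_indep P X eps sigma.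

(** Used twice: with E a rectangle for the law of W_1, and with E the event that a column is short,
    which is no rectangle, for the noise bound. *)
Lemma cond_gaussian_design (a : 'I_n -> g_sigma_algebraType design_rect -> R)
    (E : set (g_sigma_algebraType design_rect)) (B : set R) : 0 < sigma ->
  (forall i, measurable_fun setT (a i)) -> measurable E -> measurable B ->
  P ((E : set T) `&` [set w | B (\sum_i a i w * eps w i 0)]) =
  (\int[P]_(w in (E : set T)) gauss_law (sigma ^+ 2 * \sum_i a i w ^+ 2) B)%E.
Proof.
move=> sg0 ma mE mB.
apply: (@cond_gaussian_sum _ _ _ P design_rect design_rect_measurable design_rectI
  design_rectT n (fun i w => eps w i 0)) => //; first by rewrite gt_eqF.
move=> F C [A mA ->] mC; rewrite -gauss// fineK//.
apply: fin_num_measure; apply: measurableI.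
  by apply: design_rect_measurable; exists A.
rewrite (_ : [set w | _] = \bigcap_(i in [set: 'I_n]) ((fun w => eps w i 0) @^-1` C i)).
  apply: fin_bigcap_measurable => // i _.
  by rewrite -[X in measurable X]setTI; exact: meps.
by apply/seteqP; split => w /= H i; [move=> _; exact: H|exact: H].
Qed.

End design.

(** * First-order conditions of the Lasso *)

Section lasso.
Context {R : realType}.

Definition dot k (u v : 'cV[R]_k) : R := \sum_i u i 0 * v i 0.

Lemma dotE k (u v : 'cV[R]_k) : (u^T *m v) 0 0 = dot u v.
Proof. by rewrite mxE; apply: eq_bigr => i _; rewrite mxE. Qed.

Lemma dotC k (u v : 'cV[R]_k) : dot u v = dot v u.
Proof. by apply: eq_bigr => i _; rewrite mulrC. Qed.

Lemma dotDl k (u v w : 'cV[R]_k) : dot (u + v) w = dot u w + dot v w.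
Proof. by rewrite -big_split; apply: eq_bigr => i _; rewrite mxE mulrDl. Qed.

Lemma dotZl k a (u w : 'cV[R]_k) : dot (a *: u) w = a * dot u w.
Proof. by rewrite mulr_sumr; apply: eq_bigr => i _; rewrite mxE mulrA. Qed.

Lemma dotNl k (u w : 'cV[R]_k) : dot (- u) w = - dot u w.
Proof. by rewrite -scaleN1r dotZl mulN1r. Qed.

Lemma dot_mulmx n p (X : 'M[R]_(n, p)) u v : dot (X *m u) v = dot u (X^T *m v).
Proof. by rewrite -!dotE trmx_mul mulmxA. Qed.

Lemma sqnormE k (u : 'cV[R]_k) : sqnorm u = dot u u.
Proof. by apply: eq_bigr => i _; rewrite expr2. Qed.

Lemma sqnorm_ge0 k (u : 'cV[R]_k) : 0 <= sqnorm u.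
Proof. by apply: sumr_ge0 => i _; rewrite sqr_ge0. Qed.

Lemma l1norm_ge0 k (u : 'cV[R]_k) : 0 <= l1norm u.
Proof. exact: sumr_ge0. Qed.

Lemma sqnormZ k a (u : 'cV[R]_k) : sqnorm (a *: u) = a ^+ 2 * sqnorm u.
Proof. by rewrite mulr_sumr; apply: eq_bigr => i _; rewrite mxE exprMn. Qed.

Lemma sqnormD k (u v : 'cV[R]_k) :
  sqnorm (u + v) = sqnorm u + 2 * dot u v + sqnorm v.
Proof.
by rewrite !sqnormE !dotDl ![dot _ (u + v)]dotC !dotDl (dotC v u); ring.
Qed.

Lemma sqnormBZ k t (u v : 'cV[R]_k) :
  sqnorm (u - t *: v) = sqnorm u - 2 * t * dot v u + t ^+ 2 * sqnorm v.
Proof.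
rewrite -scaleNr sqnormD sqnormZ sqrrN dotC dotZl; ring.
Qed.

Lemma l1normZ k a (u : 'cV[R]_k) : l1norm (a *: u) = `|a| * l1norm u.
Proof. by rewrite mulr_sumr; apply: eq_bigr => i _; rewrite mxE normrM. Qed.

Lemma l1normD k (u v : 'cV[R]_k) : l1norm (u + v) <= l1norm u + l1norm v.
Proof. by rewrite -big_split; apply: ler_sum => i _; rewrite mxE ler_normD. Qed.

Lemma l1norm_delta k (j : 'I_k) : l1norm (delta_mx j 0 : 'cV[R]_k) = 1.
Proof.
rewrite /l1norm (bigD1 j)//= big1 => [|i ij]; rewrite !mxE.
  by rewrite !eqxx normr1 addr0.
by rewrite (negbTE ij) normr0.
Qed.

Lemma dot_le_l1norm k (u v : 'cV[R]_k) M :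
  (forall i, `|u i 0| <= M) -> `|dot u v| <= M * l1norm v.
Proof.
move=> uM; apply: le_trans (ler_norm_sum _ _ _) _; rewrite mulr_sumr.
by apply: ler_sum => i _; rewrite normrM ler_wpM2r.
Qed.

Lemma ge0_first_order (c e : R) :
  (forall t, 0 < t -> t <= 1 -> 0 <= t * c + t ^+ 2 * e) -> 0 <= c.
Proof.
move=> H; rewrite leNgt; apply/negP => c0.
(* This makes t |e| <= - c / 2, so the quadratic term cannot offset a negative slope. *)
pose t := Num.min 1 (- c / (2 * (`|e| + 1))).
have e1 : 0 < 2 * (`|e| + 1) by rewrite mulr_gt0// ltr_wpDl.
have t0 : 0 < t by rewrite lt_min ltr01 divr_gt0// oppr_gt0.
have t1 : t <= 1 by rewrite ge_min lexx.
have te : t * (2 * (`|e| + 1)) <= - c by rewrite -ler_pdivlMr// ge_min lexx orbT.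
have := H t t0 t1; rewrite expr2 -mulrA -mulrDr pmulr_rge0// => h.
have : t * e <= t * `|e| by rewrite ler_wpM2l ?ler_norm// ltW.
by nra.
Qed.

Section kkt.
Context n p (X : 'M[R]_(n, p)) (Y : 'cV[R]_n) (lam : R) (b : 'cV[R]_p).
Hypothesis n0 : (0 < n)%N.
Hypothesis bmin : is_lasso_min X Y lam b.
Let r := Y - X *m b.

Lemma lasso_obj_shift t v :
  lasso_obj X Y lam (b + t *: v) - lasso_obj X Y lam b =
  (- 2 * t * dot (X *m v) r + t ^+ 2 * sqnorm (X *m v)) / n%:R +
  2 * lam * (l1norm (b + t *: v) - l1norm b).
Proof.
rewrite /lasso_obj mulmxDr -scalemxAr opprD addrA -/r sqnormBZ; ring.
Qed.

(** One-sided derivative of the objective along v, where L bounds the slope of the l1 norm. It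
    replaces subgradients: the directions +- e_j (L = 1) and +- b (L = +- |b|_1) yield all the
    first-order conditions used. *)
Lemma lasso_direction v L :
  0 <= lam ->
  (forall t, 0 < t -> t <= 1 -> l1norm (b + t *: v) <= l1norm b + t * L) ->
  dot (X *m v) r <= n%:R * lam * L.
Proof.
move=> lam0 vL; have nR0 : 0 < n%:R :> R by rewrite ltr0n.
suff : 0 <= 2 * lam * L - 2 * dot (X *m v) r / n%:R.
  by rewrite subr_ge0 ler_pdivrMr//; nra.
apply: (@ge0_first_order _ (sqnorm (X *m v) / n%:R)) => t t0 t1.
have := bmin (b + t *: v); rewrite -subr_ge0 lasso_obj_shift => /le_trans; apply.
have := vL t t0 t1; rewrite -lerBlDl => h.
rewrite -subr_ge0.
rewrite (_ : _ - _ = 2 * lam * (t * L - (l1norm (b + t *: v) - l1norm b))).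
  by rewrite !mulr_ge0// subr_ge0.
by field; rewrite gt_eqF.
Qed.

Lemma lasso_kkt_norm : 0 <= lam -> forall j, `|dot (col j X) r| <= n%:R * lam.
Proof.
move=> lam0 j; rewrite ler_norml; apply/andP; split.
  rewrite lerNl -dotNl -[leRHS]mulr1.
  rewrite colE -mulmxN; apply: lasso_direction => // t t0 t1.
  apply: le_trans (l1normD _ _) _.
  by rewrite lerD2l scalerN -scaleNr l1normZ normrN l1norm_delta gtr0_norm.
rewrite -[leRHS]mulr1 colE; apply: lasso_direction => // t t0 t1.
by apply: le_trans (l1normD _ _) _; rewrite lerD2l l1normZ l1norm_delta gtr0_norm.
Qed.

(** Along +- b the l1 norm is exactly linear, as (1 +- t) |b|_1; for the minus sign this uses t <=
    1. *)
Lemma lasso_kkt_dot : 0 <= lam -> dot (X *m b) r = n%:R * lam * l1norm b.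
Proof.
move=> lam0; apply/eqP; rewrite eq_le; apply/andP; split.
  apply: lasso_direction => // t t0 t1.
  rewrite -[X in l1norm (X + _)]scale1r -scalerDl l1normZ.
  by rewrite ger0_norm ?addr_ge0// ?(ltW t0)// mulrDl mul1r.
rewrite -lerN2 -dotNl -mulrN -mulmxN; apply: lasso_direction => // t t0 t1.
rewrite scalerN -scaleNr -[X in l1norm (X + _)]scale1r -scalerDl l1normZ.
by rewrite ger0_norm ?subr_ge0// mulrBl mul1r mulrN.
Qed.

End kkt.
End lasso.

(** * The node-wise Lasso and the bounds on Theta *)

Section nodewise.
Context {R : realType} n p (X : 'M[R]_(n, p.+1)).

Lemma mulmx_col0 (v : 'cV[R]_p.+1) :
  X *m v = v ord0 0 *: col ord0 X + col' ord0 X *m (\col_k v (lift ord0 k) 0).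
Proof.
apply/colP => i; rewrite !mxE big_ord_recl mulrC; congr (_ + _).
by apply: eq_bigr => k _; rewrite !mxE.
Qed.

Definition nodewise_vec (g : 'cV[R]_p) : 'cV[R]_p.+1 :=
  \col_j (match unlift ord0 j with Some k => - g k 0 | None => 1 end).

Lemma mulmx_nodewise_vec g :
  X *m nodewise_vec g = col ord0 X - col' ord0 X *m g.
Proof.
rewrite mulmx_col0 mxE unlift_none scale1r; congr (_ + _).
by rewrite -mulmxN; congr (_ *m _); apply/colP => k; rewrite !mxE liftK.
Qed.

Lemma quad_Sigma_hat (v : 'cV[R]_p.+1) :
  (v^T *m Sigma_hat X *m v) 0 0 = sqnorm (X *m v) / n%:R.
Proof.
rewrite /Sigma_hat -scalemxAr -scalemxAl mxE mulrC; congr (_ / _).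
by rewrite -!mulmxA mulmxA -trmx_mul dotE sqnormE.
Qed.

Context (lam : R) (g : 'cV[R]_p).
Hypothesis n0 : (0 < n)%N.
Hypothesis lam0 : 0 <= lam.
Hypothesis gmin : is_nodewise_min X lam g.
Let r := col ord0 X - col' ord0 X *m g.
Let tau := tau_hat2 X lam g.
Let Th := Theta1 X lam g.

Lemma mulmx_Theta1 : X *m Th = tau^-1 *: r.
Proof.
by rewrite /Th /Theta1 -/(nodewise_vec g) -scalemxAr mulmx_nodewise_vec.
Qed.

(** Write X_1 = r + X_{-1} gamma and apply the first-order condition along gamma. The identity makes
    the first entry of Sigma Theta - e_1 vanish, and it expresses tau^2 by the residual alone. *)
Lemma tau_hat2E : dot (col ord0 X) r = n%:R * tau.
Proof.
have nR0 : n%:R != 0 :> R by rewrite pnatr_eq0 -lt0n.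
have -> : col ord0 X = r + col' ord0 X *m g by rewrite subrK.
rewrite dotDl -sqnormE (lasso_kkt_dot n0 gmin)// /tau /tau_hat2 /tau_tilde2 -/r.
by field.
Qed.

Lemma Omega_hat_le : 0 < tau -> (Th^T *m Sigma_hat X *m Th) 0 0 <= tau^-1.
Proof.
move=> t0; rewrite quad_Sigma_hat mulmx_Theta1 sqnormZ -mulrA.
rewrite -[leRHS]mulr1 -{2}(mulVf (lt0r_neq0 t0)) exprVn expr2 invfM -!mulrA.
rewrite ler_pM2l ?invr_gt0// ler_pM2l ?invr_gt0//.
by rewrite /tau /tau_hat2 lerDl mulr_ge0// l1norm_ge0.
Qed.

Lemma Sigma_hat_Theta1_bound : 0 < tau ->
  forall j, `|(Sigma_hat X *m Th - e1 R p) j 0| <= lam / tau.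
Proof.
move=> t0 j; have nR0 : 0 < n%:R :> R by rewrite ltr0n.
have -> : (Sigma_hat X *m Th - e1 R p) j 0 =
    dot (col j X) r / (n%:R * tau) - (j == ord0)%:R.
  rewrite mxE /Sigma_hat -scalemxAl -mulmxA mulmx_Theta1 -scalemxAr !mxE eqxx andbT.
  congr (_ - _); rewrite mulrA -invfM mulrC; congr (_ / _).
  by apply: eq_bigr => i _; rewrite !mxE.
case: (unliftP ord0 j) => [k ->|->]; last first.
  rewrite eqxx tau_hat2E divff ?subrr ?normr0 ?divr_ge0 ?(ltW t0)//.
  by rewrite mulf_neq0 ?gt_eqF.
rewrite (_ : (lift ord0 k == ord0) = false)// subr0.
rewrite normrM normfV [`|n%:R * tau|]gtr0_norm ?mulr_gt0//.
rewrite ler_pdivrMr ?mulr_gt0//.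
rewrite [n%:R * tau]mulrC mulrA divfK ?gt_eqF// [lam * _]mulrC.
have -> : col (lift ord0 k) X = col k (col' ord0 X) by apply/colP => i; rewrite !mxE.
exact: (lasso_kkt_norm n0 gmin).
Qed.

End nodewise.

(** * Measurability of the Lasso residual *)

Section residual.
Context {R : realType}.

(** A sequence through all rational vectors; codes of no vector give 0. *)
Definition rat_vec p (m : nat) : 'cV[R]_p :=
  map_mx ratr (odflt 0 (unpickle m : option 'cV[rat]_p)).

Lemma cvg_sumr (T : Type) (F : set_system T) {FF : Filter F} (I : finType)
    (f : I -> T -> R) (l : I -> R) : (forall i, f i x @[x --> F] --> l i) ->
  \sum_i f i x @[x --> F] --> \sum_i l i.
Proof. by move=> fl; apply: cvg_big => //; exact: add_continuous. Qed.

Lemma lasso_obj_continuous n p (A : 'M[R]_(n, p)) (y : 'cV[R]_n) lam :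
  continuous (fun b : 'cV[R]_p => lasso_obj A y lam b : R).
Proof.
move=> b.
have quad : sqnorm (y - A *m b') @[b' --> b] --> sqnorm (y - A *m b).
  apply: (@cvg_sumr _ (nbhs b) _) => i.
  apply: (cvg_comp (fun b' : 'cV[R]_p => (y - A *m b') i 0) (fun x : R => x ^+ 2));
    last exact: exprn_continuous.
  rewrite (_ : (fun b' : 'cV_p => _) =
      fun b' : 'cV[R]_p => y i 0 - \sum_j A i j * b' j 0); last first.
    by apply/funext => b'; rewrite !mxE.
  rewrite (_ : (y - A *m b) i 0 = y i 0 - \sum_j A i j * b j 0); last by rewrite !mxE.
  have lin : \sum_j A i j * b' j 0 @[b' --> b] --> \sum_j A i j * b j 0.
    apply: (@cvg_sumr _ (nbhs b) _) => j.
    apply: (@cvgMl_tmp R _ (nbhs b) _ (fun b' : 'cV[R]_p => b' j 0)).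
    exact: coord_continuous.
  by apply: cvgB; [exact: cvg_cst|exact: lin].
have l1 : l1norm b' @[b' --> b] --> l1norm b.
  by apply: (@cvg_sumr _ (nbhs b) _) => j; apply: cvg_norm; exact: coord_continuous.
exact: (@cvgD R R^o _ _ _ _ _ _ _ (cvgMr_tmp quad) (cvgMl_tmp l1)).
Qed.

Lemma rat_vec_dense p (b : 'cV[R]_p) (U : set 'cV[R]_p) :
  nbhs b U -> exists m, U (rat_vec p m).
Proof.
move=> /nbhs_ballP[e e0 beU].
have [q bq] : exists q : 'cV[rat]_p, forall i, ball (b i 0) e (ratr (q i 0)).
  have H i : exists q : rat, ball (b i 0) e (ratr q).
    have /rat_in_itvoo[q] : b i 0 < b i 0 + e by rewrite ltrDl.
    rewrite in_itv/= => /andP[bq qb]; exists q.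
    by rewrite /ball/= ltr_norml; apply/andP; split; lra.
  have [f Hf] := choice H.
  by exists (\col_i f i) => i; rewrite mxE; exact: Hf.
exists (pickle q); apply: beU; rewrite /rat_vec pickleK/=.
by split=> // i j; rewrite (ord1 j) mxE; exact: bq.
Qed.

(** The optimal value as a countable infimum: [infs _ 0] is the infimum of the whole sequence, a
    form in which measurability in the data passes to the infimum. *)
Definition lasso_inf n p (A : 'M[R]_(n, p)) (y : 'cV[R]_n) lam : R :=
  infs (fun m => lasso_obj A y lam (rat_vec p m)) 0.

Section bounds.
Context n p (A : 'M[R]_(n, p)) (y : 'cV[R]_n) (lam : R).
Hypothesis lam0 : 0 <= lam.

Lemma lasso_obj_ge0 b : 0 <= lasso_obj A y lam b.
Proof.
by rewrite addr_ge0// ?divr_ge0 ?mulr_ge0 ?sqnorm_ge0 ?l1norm_ge0.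
Qed.

Lemma lasso_inf_le b : lasso_inf A y lam <= lasso_obj A y lam b.
Proof.
apply/ler_addgt0Pr => e e0.
have [m] : exists m, [set b' | lasso_obj A y lam b' < lasso_obj A y lam b + e] (rat_vec p m).
  apply: (@rat_vec_dense p b).
  have := @lasso_obj_continuous n p A y lam b.
  by move=> /(_ [set x | x < lasso_obj A y lam b + e]); apply; apply: lt_nbhsl; rewrite ltrDl.
move=> /= /ltW; apply: le_trans.
apply: ge_inf; last by exists m.
by exists 0 => _ [k _ <-]; exact: lasso_obj_ge0.
Qed.

Lemma lasso_inf_ge c : (forall b, c <= lasso_obj A y lam b) -> c <= lasso_inf A y lam.
Proof.
move=> H; apply: lb_le_inf; first by exists (lasso_obj A y lam (rat_vec p 0)), 0%N.
by move=> _ [k _ <-].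
Qed.

End bounds.

(** Joint convexity in (y, b), from |u1 - u2|^2 >= 0 and the triangle inequality for the l1 norm. *)
Lemma lasso_obj_midpoint n p (A : 'M[R]_(n, p)) (y1 y2 : 'cV[R]_n) lam b1 b2 :
  0 <= lam ->
  2 * lasso_obj A (2^-1 *: (y1 + y2)) lam (2^-1 *: (b1 + b2)) <=
  lasso_obj A y1 lam b1 + lasso_obj A y2 lam b2.
Proof.
move=> lam0; rewrite /lasso_obj.
have -> : 2^-1 *: (y1 + y2) - A *m (2^-1 *: (b1 + b2)) =
    2^-1 *: ((y1 - A *m b1) + (y2 - A *m b2)).
  by rewrite -scalemxAr -scalerBr mulmxDr opprD addrACA.
set u1 := y1 - _; set u2 := y2 - _.
have n0 : 0 <= (n%:R : R)^-1 by rewrite invr_ge0.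
have := ler_wpM2l lam0 (l1normD b1 b2).
have : sqnorm (u1 + u2) <= 2 * (sqnorm u1 + sqnorm u2).
  have : 0 <= sqnorm (u1 - u2) by exact: sqnorm_ge0.
  have := sqnormBZ 1 u1 u2; rewrite scale1r => ->.
  by rewrite sqnormD (dotC u2); lra.
move=> /(ler_wpM2r n0); rewrite sqnormZ l1normZ gtr0_norm; last by rewrite invr_gt0.
by rewrite exprVn; lra.
Qed.

(* Half the [y]-gradient of the optimal value is the residual over [n]; joint
   convexity of the objective gives the lower bound on the difference quotient. *)
Lemma lasso_inf_difference n p (A : 'M[R]_(n, p)) (y : 'cV[R]_n) lam b (i : 'I_n) t :
  0 <= lam -> is_lasso_min A y lam b -> 0 < t ->
  `|n%:R / (2 * t) * (lasso_inf A (y + t *: delta_mx i 0) lam - lasso_inf A y lam)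
     - (y - A *m b) i 0| <= t.
Proof.
move=> lam0 bmin t0.
have n0 : 0 < n%:R :> R by rewrite ltr0n (leq_ltn_trans _ (ltn_ord i)).
have V0 : lasso_inf A y lam = lasso_obj A y lam b.
  by apply/eqP; rewrite eq_le lasso_inf_le// lasso_inf_ge.
have O s : lasso_obj A (y + s *: delta_mx i 0) lam b =
    lasso_obj A y lam b + (2 * s * (y - A *m b) i 0 + s ^+ 2) / n%:R.
  rewrite /lasso_obj (_ : y + _ - A *m b = (y - A *m b) + s *: delta_mx i 0); last exact: addrAC.
  rewrite [sqnorm (_ + _ *: _)]sqnormD sqnormZ dotC dotZl.
  have -> : dot (delta_mx i 0) (y - A *m b) = (y - A *m b) i 0.
    rewrite /dot (bigD1 i)//= big1 ?addr0 => [|j ji]; rewrite mxE ?eqxx ?mul1r//.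
    by rewrite (negbTE ji) mul0r.
  have -> : sqnorm (delta_mx i 0 : 'cV[R]_n) = 1.
    rewrite /sqnorm (bigD1 i)//= big1 ?addr0 => [|j ji]; rewrite mxE ?eqxx ?expr1n//.
    by rewrite (negbTE ji) expr0n.
  by ring.
have U := lasso_inf_le A (y + t *: delta_mx i 0) lam0 b.
(* The points y + t e_i and y - t e_i have midpoint y, where no coefficient vector beats [b];
   pairing any b1 at the first with [b] at the second bounds the value at b1 from below. *)
have L : 2 * lasso_obj A y lam b - lasso_obj A (y + (- t) *: delta_mx i 0) lam b
    <= lasso_inf A (y + t *: delta_mx i 0) lam.
  apply: lasso_inf_ge => b1; rewrite lerBlDr.
  have := lasso_obj_midpoint A (y + t *: delta_mx i 0) (y + (- t) *: delta_mx i 0) b1 b lam0.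
  apply: le_trans; rewrite ler_pM2l//.
  rewrite (_ : 2^-1 *: (y + _ + _) = y); first exact: bmin.
  rewrite addrACA scaleNr subrr addr0 -mulr2n.
  by rewrite -[y *+ 2]scaler_nat scalerA mulVf// scale1r.
rewrite V0; move: U L; rewrite !O; set V := lasso_inf _ _ _; set ri := (y - _) i 0.
set o := lasso_obj _ _ _ _ => U L.
have -> : n%:R / (2 * t) * (V - o) - ri = (n%:R * (V - o) - 2 * t * ri) / (2 * t).
  by field; rewrite gt_eqF.
rewrite normrM normfV (@gtr0_norm _ (2 * t)) ?mulr_gt0// ler_pdivrMr ?mulr_gt0//.
have U' : n%:R * (V - o) <= 2 * t * ri + t ^+ 2.
  by rewrite [n%:R * _]mulrC -ler_pdivlMr// lerBlDl.
have L' : 2 * t * ri - t ^+ 2 <= n%:R * (V - o).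
  rewrite [n%:R * _]mulrC -ler_pdivrMr//.
  apply: (@le_trans _ _ (2 * o - (o + (2 * - t * ri + (- t) ^+ 2) / n%:R) - o)).
    by rewrite le_eqVlt; apply/orP; left; apply/eqP; ring.
  by rewrite lerD2r.
by rewrite ler_norml; apply/andP; split; nra.
Qed.

Lemma measurable_lasso_residual d (T : measurableType d) n p
    (A : T -> 'M[R]_(n, p)) (y : T -> 'cV[R]_n) lam (b : T -> 'cV[R]_p) i :
  0 <= lam ->
  (forall i j, measurable_fun setT (fun w => A w i j)) ->
  (forall i, measurable_fun setT (fun w => y w i 0)) ->
  (forall w, is_lasso_min (A w) (y w) lam (b w)) ->
  measurable_fun setT (fun w => (y w - A w *m b w) i 0).
Proof.
move=> lam0 mA my bmin.
have mO (v : 'cV[R]_n) (q : 'cV[R]_p) :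
    measurable_fun setT (fun w => lasso_obj (A w) (y w + v) lam q).
  apply: measurable_funD => //; apply: measurable_funM => //.
  apply: measurable_sum => k; apply: measurable_funX.
  rewrite (_ : (fun w => _) = fun w => y w k 0 + v k 0 - \sum_j A w k j * q j 0); last first.
    by apply/funext => w; rewrite !mxE.
  apply: measurable_funB; first exact: measurable_funD.
  by apply: measurable_sum => j; exact: measurable_funM.
have mV v : measurable_fun setT (fun w => lasso_inf (A w) (y w + v) lam).
  apply: measurable_fun_infs => [w _|m]; last exact: mO.
  by exists 0 => _ [k _ <-]; exact: lasso_obj_ge0.
pose t k : R := k.+1%:R^-1.
apply: (@measurable_fun_cvg _ _ _ _ (fun k w => n%:R / (2 * t k) *
  (lasso_inf (A w) (y w + t k *: delta_mx i 0) lam - lasso_inf (A w) (y w + 0) lam))).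
  by move=> k; apply: measurable_funM => //; apply: measurable_funB.
move=> w _; apply/cvgrPdist_le => e e0.
have : t k @[k --> \oo] --> (0 : R) by exact: cvg_harmonic.
move=> /cvgrPdist_le/(_ e e0); apply: filterS => k.
rewrite sub0r normrN ger0_norm ?invr_ge0// => tke.
rewrite distrC addr0; apply: le_trans tke.
by apply: lasso_inf_difference => //; rewrite invr_gt0.
Qed.

End residual.

(** * Lower bound on tau^2 *)

Section norm2.
Context {R : realType}.

Definition norm2 k (u : 'cV[R]_k) : R := Num.sqrt (sqnorm u).

Lemma norm2_ge0 k (u : 'cV[R]_k) : 0 <= norm2 u.
Proof. exact: sqrtr_ge0. Qed.

Lemma sqr_norm2 k (u : 'cV[R]_k) : norm2 u ^+ 2 = sqnorm u.
Proof. by rewrite sqr_sqrtr// sqnorm_ge0. Qed.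

Lemma l0normE k (u : 'cV[R]_k) : l0norm u = #|[set i | u i 0 != 0]%SET|.
Proof. by apply: eq_card => i; rewrite inE; apply/idP/idP; rewrite inE. Qed.

Lemma sqnorm_eq0 k (u : 'cV[R]_k) : (sqnorm u == 0) = (u == 0).
Proof.
apply/idP/eqP => [|->]; last first.
  by rewrite /sqnorm big1// => i _; rewrite mxE expr0n.
rewrite psumr_eq0 => [/allP u0|i _]; last exact: sqr_ge0.
by apply/colP => i; apply/eqP; have := u0 i; rewrite mem_index_enum mxE sqrf_eq0; apply.
Qed.

Lemma sqnorm0 k : sqnorm (0 : 'cV[R]_k) = 0.
Proof. by apply/eqP; rewrite sqnorm_eq0. Qed.

Lemma dot_cauchy k (u v : 'cV[R]_k) : dot u v ^+ 2 <= sqnorm u * sqnorm v.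
Proof.
have [/eqP|v0] := eqVneq (sqnorm v) 0.
  rewrite sqnorm_eq0 => /eqP ->.
  rewrite {1}/dot big1 ?expr0n ?mulr_ge0 ?sqnorm_ge0// => i _.
  by rewrite mxE mulr0.
have vp : 0 < sqnorm v by rewrite lt_def v0 sqnorm_ge0.
have := sqnorm_ge0 (u - (dot v u / sqnorm v) *: v).
rewrite sqnormBZ (dotC u v).
rewrite (_ : _ + _ = (sqnorm u * sqnorm v - dot v u ^+ 2) / sqnorm v); last by field.
by rewrite pmulr_lge0 ?invr_gt0// subr_ge0.
Qed.

Lemma norm2D k (u v : 'cV[R]_k) : norm2 (u + v) <= norm2 u + norm2 v.
Proof.
rewrite -ler_sqr ?nnegrE ?addr_ge0 ?norm2_ge0// sqr_norm2 sqnormD sqrrD !sqr_norm2.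
rewrite lerD2r lerD2l mulr2n -mulr2n -mulr_natl ler_pM2l//.
apply: le_trans (ler_norm _) _.
rewrite -ler_sqr ?nnegrE ?mulr_ge0 ?norm2_ge0// exprMn !sqr_norm2.
by rewrite real_normK ?num_real// dot_cauchy.
Qed.

(** The Frobenius bound. It shows the set defining [phi_max] bounded above, so that its [sup] is a
    true upper bound. *)
Lemma sqnorm_mulmx_le n p (X : 'M[R]_(n, p)) (z : 'cV[R]_p) :
  sqnorm (X *m z) <= (\sum_i sqnorm (row i X)^T) * sqnorm z.
Proof.
rewrite mulr_suml; apply: ler_sum => i _.
rewrite (_ : (X *m z) i 0 = dot (row i X)^T z); first exact: dot_cauchy.
by rewrite mxE; apply: eq_bigr => j _; rewrite !mxE.
Qed.

Lemma phi_min_sqnorm n p (X : 'M[R]_(n, p)) s c (z : 'cV[R]_p) : (0 < n)%N ->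
  c <= phi_min X s -> (1 <= l0norm z <= s)%N -> c * (n%:R * sqnorm z) <= sqnorm (X *m z).
Proof.
move=> n0 cX zs; have z0 : 0 < n%:R * sqnorm z.
  rewrite mulr_gt0 ?ltr0n// lt_def sqnorm_ge0 sqnorm_eq0 andbT.
  apply: contraTneq zs => ->; rewrite negb_and -ltnNge ltnS leqn0 l0normE cards_eq0.
  by apply/orP; left; apply/eqP/setP => i; rewrite !inE mxE eqxx.
rewrite -ler_pdivlMr//; apply: le_trans cX _; apply: ge_inf; last by exists z.
exists 0 => _ [y _ <-]; by rewrite divr_ge0 ?mulr_ge0 ?sqnorm_ge0.
Qed.

Lemma phi_max_sqnorm n p (X : 'M[R]_(n, p)) s c (z : 'cV[R]_p) : (0 < n)%N ->
  phi_max X s <= c -> (l0norm z <= s)%N -> sqnorm (X *m z) <= c * (n%:R * sqnorm z).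
Proof.
move=> n0 cX zs; have nR0 : 0 < n%:R :> R by rewrite ltr0n.
have [->|zn0] := eqVneq z 0.
  by rewrite mulmx0 !sqnorm0 !mulr0.
have sz : 0 < sqnorm z by rewrite lt_def sqnorm_ge0 sqnorm_eq0 zn0.
have z0 : 0 < n%:R * sqnorm z by rewrite mulr_gt0.
rewrite -ler_pdivrMr//; apply: le_trans cX; apply: ub_le_sup; last first.
  exists z => //=; rewrite zs andbT l0normE card_gt0; apply: contraNneq zn0 => S0.
  apply/eqP/colP => i; rewrite mxE; apply/eqP/negPn/negP => zi.
  by have : i \in [set i | z i 0 != 0]%SET by [rewrite inE]; rewrite S0 inE.
exists ((\sum_i sqnorm (row i X)^T) / n%:R) => _ [y /= /andP[y1 _] <-].
have [->|yn0] := eqVneq y 0.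
  rewrite mulmx0 !sqnorm0 mul0r divr_ge0//.
  by apply: sumr_ge0 => i _; exact: sqnorm_ge0.
have sy : 0 < sqnorm y by rewrite lt_def sqnorm_ge0 sqnorm_eq0 yn0.
rewrite invfM [n%:R^-1 * _]mulrC mulrA ler_pM2r ?invr_gt0// ler_pdivrMr//.
exact: sqnorm_mulmx_le.
Qed.

(** Greedy selection: each step adds a maximizer of f over what is left. *)
Lemma top_subset (I : finType) (f : I -> R) (A : {set I}) m : (m <= #|A|)%N ->
  exists S : {set I}, [/\ S \subset A, #|S| = m &
    forall i j, i \in S -> j \in A :\: S -> f j <= f i].
Proof.
elim: m => [|m IH] mA.
  by exists finset.set0; rewrite finset.sub0set cards0; split => // i j; rewrite inE.
have [S [SA Sm HS]] := IH (ltnW mA).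
have /card_gt0P[i0 i0A] : (0 < #|A :\: S|)%N.
  by rewrite cardsD (finset.setIidPr SA) Sm subn_gt0.
pose i1 := [arg max_(i > i0 in A :\: S) f i]%O.
have [i1A i1max] : i1 \in A :\: S /\ forall j, j \in A :\: S -> f j <= f i1.
  by rewrite /i1; case: arg_maxP.
move: (i1A); rewrite inE => /andP[i1S i1A'].
exists (i1 |: S)%SET; split.
- by rewrite finset.subUset finset.sub1set i1A'.
- by rewrite cardsU1 i1S Sm.
move=> i j; rewrite !inE negb_or -andbA => /orP[/eqP->|iS] /and3P[ji jS jA].
  by apply: i1max; rewrite inE jS.
by apply: HS => //; rewrite inE jS.
Qed.

Lemma restrictD k (S : {set 'I_k}) (z : 'cV[R]_k) :
  z = Defs.restrict S z + Defs.restrict (~: S) z.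
Proof.
by apply/colP => i; rewrite !mxE inE; case: ifP; rewrite ?addr0 ?add0r.
Qed.

Lemma l1norm_restrict k (S : {set 'I_k}) (z : 'cV[R]_k) :
  l1norm (Defs.restrict S z) = \sum_(i in S) `|z i 0|.
Proof.
rewrite [RHS]big_mkcond; apply: eq_bigr => i _.
by rewrite mxE; case: ifP; rewrite ?normr0.
Qed.

Lemma sqnorm_restrict k (S : {set 'I_k}) (z : 'cV[R]_k) :
  sqnorm (Defs.restrict S z) = \sum_(i in S) z i 0 ^+ 2.
Proof.
rewrite [RHS]big_mkcond; apply: eq_bigr => i _.
by rewrite mxE; case: ifP; rewrite ?expr0n.
Qed.

Lemma l1norm_restrictD k (S : {set 'I_k}) (z : 'cV[R]_k) :
  l1norm z = l1norm (Defs.restrict S z) + l1norm (Defs.restrict (~: S) z).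
Proof.
rewrite !l1norm_restrict /l1norm (bigID (mem S))/=; congr (_ + _).
by apply: eq_bigl => i; rewrite inE.
Qed.

Lemma l0norm_restrict k (S : {set 'I_k}) (z : 'cV[R]_k) :
  (l0norm (Defs.restrict S z) <= #|S|)%N.
Proof.
rewrite l0normE; apply/subset_leq_card/fintype.subsetP => i; rewrite inE mxE.
by case: ifP => //; rewrite eqxx.
Qed.

Lemma norm2_le_sup k (S : {set 'I_k}) (z : 'cV[R]_k) m (t : R) : 0 <= t ->
  (#|S| <= m)%N -> (forall i, `|z i 0| <= t) ->
  norm2 (Defs.restrict S z) <= Num.sqrt m%:R * t.
Proof.
move=> t0 Sm zt; rewrite -ler_sqr ?nnegrE ?mulr_ge0 ?sqrtr_ge0 ?norm2_ge0//.
rewrite sqr_norm2 exprMn sqr_sqrtr ?ler0n// sqnorm_restrict.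
apply: (@le_trans _ _ (\sum_(i in S) t ^+ 2)).
  apply: ler_sum => i _; rewrite -[z i 0 ^+ 2]real_normK ?num_real//.
  by rewrite ler_sqr ?nnegrE.
by rewrite sumr_const -[_ *+ #|_|]mulr_natl ler_wpM2r ?sqr_ge0// ler_nat.
Qed.

(* Peel off the [m] largest entries repeatedly: each block's sup norm is at most
   the average of the previous block. *)
Lemma block_bound n p (X : 'M[R]_(n, p)) m (M : R) (v : 'cV[R]_p) (t : R) :
  (0 < m)%N -> 0 <= M -> 0 <= t ->
  (forall z : 'cV[R]_p, (l0norm z <= m)%N -> norm2 (X *m z) <= M * norm2 z) ->
  (forall i, `|v i 0| <= t) ->
  norm2 (X *m v) <= M * (Num.sqrt m%:R * t + l1norm v / Num.sqrt m%:R).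
Proof.
move=> m0 M0 t0 HM vt.
have sm0 : 0 < Num.sqrt m%:R :> R by rewrite sqrtr_gt0 ltr0n.
(* Induction on a bound for the support, with the sup bound s free: it shrinks from block to
   block. *)
suff H : forall (k : nat) (A : {set 'I_p}) (u : 'cV[R]_p) (s : R),
    (#|A| <= k)%N -> (forall i, i \notin A -> u i 0 = 0) ->
    0 <= s -> (forall i, `|u i 0| <= s) ->
    norm2 (X *m u) <= M * (Num.sqrt m%:R * s + l1norm u / Num.sqrt m%:R).
  by apply: (H _ [set: 'I_p]%SET) => // i; rewrite inE.
have uA (A : {set 'I_p}) (u : 'cV[R]_p) :
    (forall i, i \notin A -> u i 0 = 0) -> u = Defs.restrict A u.
  by move=> H; apply/colP => i; rewrite mxE; case: ifPn => // /H.
elim=> [|k IH] A u s Ak u0 s0 us.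
  have -> : u = 0.
    apply/colP => i; rewrite mxE; apply: u0.
    by move: Ak; rewrite leqn0 cards_eq0 => /eqP ->; rewrite inE.
  rewrite mulmx0 /norm2 sqnorm0 sqrtr0.
  by rewrite mulr_ge0// addr_ge0 ?mulr_ge0 ?invr_ge0 ?l1norm_ge0 ?sqrtr_ge0.
have [Am|mA] := leqP #|A| m.
  have := HM u; rewrite {1}(uA A u u0) => /(_ (leq_trans (l0norm_restrict _ _) Am)).
  move=> /le_trans; apply; rewrite ler_wpM2l// (uA A u u0).
  apply: le_trans (norm2_le_sup s0 Am us) _.
  by rewrite lerDl divr_ge0 ?l1norm_ge0 ?sqrtr_ge0.
have [S [SA Sm HS]] := top_subset (fun i => `|u i 0|) (ltnW mA).
pose u1 := Defs.restrict S u; pose u2 := Defs.restrict (~: S) u.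
have uE : u = u1 + u2 by exact: restrictD.
have nu1 : norm2 (X *m u1) <= M * (Num.sqrt m%:R * s).
  apply: le_trans (HM _ _) _; first by rewrite -Sm l0norm_restrict.
  by rewrite ler_wpM2l// norm2_le_sup// Sm.
pose s' := l1norm u1 / m%:R.
have s'0 : 0 <= s' by rewrite divr_ge0// l1norm_ge0.
have u2s i : `|u2 i 0| <= s'.
  rewrite mxE inE; case: ifPn => iS; last by rewrite normr0.
  have [iA|/u0->] := boolP (i \in A); last by rewrite normr0.
  rewrite ler_pdivlMr ?ltr0n// l1norm_restrict.
  rewrite mulr_natr -Sm -sumr_const; apply: ler_sum => j jS.
  by apply: HS => //; rewrite inE iS.
have nu2 := IH (A :\: S) u2 s' _ _ s'0 u2s.
rewrite {1}uE mulmxDr; apply: le_trans (norm2D _ _) _.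
apply: le_trans (lerD nu1 (nu2 _ _)) _.
- rewrite cardsD (finset.setIidPr SA) Sm -ltnS (leq_trans _ Ak)// ltn_subLR ?(ltnW mA)//.
  by rewrite -[ltnLHS]add0n ltn_add2r.
- by move=> i; rewrite !mxE !inE; case: (i \in S) => //= /u0->.
(* Since s' is the average of the removed block, sqrt m * s' = |u1|_1 / sqrt m: the l1 mass of that
   block pays for the next one, and the sum telescopes. *)
rewrite -mulrDr ler_wpM2l// lerD2l (l1norm_restrictD S u) -/u1 -/u2 mulrDl.
rewrite lerD2r /s' le_eqVlt; apply/orP; left; apply/eqP.
have -> : (m%:R : R) = Num.sqrt m%:R ^+ 2 by rewrite sqr_sqrtr.
rewrite sqrtr_sqr ger0_norm ?sqrtr_ge0//; field; exact: lt0r_neq0.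
Qed.

End norm2.

(** * The node-wise residual and tau^2 *)

Section nodewise_lower.
Context {R : realType}.

Lemma norm2N k (u : 'cV[R]_k) : norm2 (- u) = norm2 u.
Proof. by rewrite /norm2 -scaleN1r sqnormZ sqrrN expr1n mul1r. Qed.

Lemma sum_nodewise_vec p (g : 'cV[R]_p) :
  \sum_(j < p.+1 | j != ord0) `|nodewise_vec g j 0| = l1norm g.
Proof.
rewrite big_mkcond big_ord_recl eqxx/= add0r; apply: eq_bigr => k _.
by rewrite mxE liftK normrN.
Qed.

(** The first entry of (1, -gamma) equals 1, so the sparse part containing it has norm at least 1
    whatever gamma is. It takes one of the m slots, leaving m - 1 for the largest entries of
    gamma. *)
Lemma nodewise_residual_lower n p (X : 'M[R]_(n, p.+1)) (g : 'cV[R]_p) m Cmin Cmax :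
  (0 < n)%N -> (1 < m)%N -> (m <= n)%N -> (n < p.+1)%N -> 0 <= Cmin -> 0 <= Cmax ->
  Cmin <= phi_min X m -> phi_max X n <= Cmax ->
  Num.sqrt Cmin * Num.sqrt n%:R - 3 * Num.sqrt Cmax * Num.sqrt n%:R * l1norm g / Num.sqrt m%:R
    <= norm2 (col ord0 X - col' ord0 X *m g).
Proof.
move=> n0 m1 mn np Cmin0 Cmax0 hmin hmax.
have m0 : (0 < m)%N by exact: ltnW.
have sm0 : 0 < Num.sqrt m%:R :> R by rewrite sqrtr_gt0 ltr0n.
rewrite -mulmx_nodewise_vec; set z := nodewise_vec g; set L := l1norm g.
pose M := Num.sqrt Cmax * Num.sqrt n%:R.
have M0 : 0 <= M by rewrite mulr_ge0 ?sqrtr_ge0.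
have HM (u : 'cV[R]_p.+1) : (l0norm u <= m)%N -> norm2 (X *m u) <= M * norm2 u.
  move=> um; rewrite -ler_sqr ?nnegrE ?mulr_ge0 ?norm2_ge0//.
  rewrite !exprMn !sqr_norm2 !sqr_sqrtr// -mulrA.
  by apply: (phi_max_sqnorm n0 hmax); exact: leq_trans mn.
pose A : {set 'I_p.+1} := (~: [set ord0])%SET.
have cA : #|A| = p by rewrite cardsC1 card_ord.
have [|S [SA Sm HS]] := @top_subset R _ (fun i => `|z i 0|) A m.-1.
  by rewrite cA -ltnS prednK//; exact: leq_trans mn (ltnW np).
have S0 : ord0 \notin S.
  by apply/negP => /(fintype.subsetP SA); rewrite !inE eqxx.
pose S' : {set 'I_p.+1} := (ord0 |: S)%SET.
have cS' : #|S'| = m by rewrite cardsU1 S0 Sm add1n prednK.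
pose u := Defs.restrict S' z; pose v := Defs.restrict (~: S')%SET z.
have zE : z = u + v by exact: restrictD.
have L0 : 0 <= L := l1norm_ge0 _.
have m1n : (0 < m.-1)%N by rewrite -ltnS prednK.
have m1R : 0 < m.-1%:R :> R by rewrite ltr0n.
have vt i : `|v i 0| <= L / m.-1%:R.
  rewrite mxE !inE; case: ifPn => [|_]; last by rewrite normr0 divr_ge0.
  rewrite negb_or => /andP[i0 iS].
  rewrite ler_pdivlMr// mulr_natr -Sm -sumr_const.
  apply: (@le_trans _ _ (\sum_(j in S) `|z j 0|)).
    by apply: ler_sum => j jS; apply: HS => //; rewrite !inE iS.
  rewrite /L -(sum_nodewise_vec g) [leLHS]big_mkcond [leRHS]big_mkcond.
  apply: ler_sum => j _; case: ifPn => [jS|_]; last by case: ifP.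
  by rewrite ifT//; apply: contraNneq S0 => <-.
have v1 : l1norm v <= L.
  rewrite /L -(sum_nodewise_vec g) [leRHS]big_mkcond /l1norm; apply: ler_sum => j _.
  rewrite mxE !inE negb_or; case: (j == ord0) => /=; first by rewrite normr0.
  by case: ifP; rewrite ?normr0.
have nv : norm2 (X *m v) <= 3 * M * L / Num.sqrt m%:R.
  apply: le_trans (block_bound m0 M0 _ HM vt) _; first by rewrite divr_ge0.
  (* The 3 is 2 + 1: the entries left over are at most L / (m - 1) <= 2 L / m, as m >= 2, and the
     block bound adds the l1 term once. *)
  rewrite (_ : 3 * M * L / _ = M * (2 * (L / Num.sqrt m%:R) + L / Num.sqrt m%:R)); last by ring.
  rewrite ler_wpM2l//.
  apply: lerD; last by rewrite ler_wpM2r// invr_ge0 ltW.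
  have -> : 2 * (L / Num.sqrt m%:R) = Num.sqrt m%:R * (L / (m%:R / 2)).
    have mE : (m%:R : R) = Num.sqrt m%:R ^+ 2 by rewrite sqr_sqrtr.
    move: mE (lt0r_neq0 sm0); set q := Num.sqrt _ => -> q0.
    by field.
  rewrite ler_wpM2l ?(ltW sm0)// ler_wpM2l// lef_pV2 ?posrE ?divr_gt0 ?ltr0n//.
  rewrite ler_pdivrMr// -natrM ler_nat -[in leqLHS](prednK m0) muln2 -addnn.
  by rewrite -add1n leq_add2r.
have nu : Num.sqrt Cmin * Num.sqrt n%:R <= norm2 (X *m u).
  rewrite -ler_sqr ?nnegrE ?mulr_ge0 ?norm2_ge0 ?sqrtr_ge0//.
  rewrite exprMn sqr_norm2 !sqr_sqrtr//.
  have u0 : u ord0 0 = 1 by rewrite !mxE !inE eqxx unlift_none.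
  apply: le_trans (phi_min_sqnorm n0 hmin _); last first.
    apply/andP; split; last by rewrite -cS' l0norm_restrict.
    by rewrite l0normE card_gt0; apply/set0Pn; exists ord0; rewrite inE u0 oner_neq0.
  rewrite ler_wpM2l// -[leLHS]mulr1 ler_wpM2l// /sqnorm (bigD1 ord0)//= u0 expr1n.
  by rewrite lerDl sumr_ge0// => i _; exact: sqr_ge0.
rewrite lerBlDr; apply: le_trans nu _.
have -> : X *m u = X *m z - X *m v by rewrite zE mulmxDr addrK.
apply: le_trans (norm2D _ _) _; rewrite norm2N lerD2l.
by apply: le_trans nv _; rewrite /M !mulrA.
Qed.

(** The second constant is the threshold c in |gamma|_1 <= c sqrt n at which, with n / m = K, the
    subtracted term of the residual bound is half the main term. Below it |r|^2 / n >= Cmin / 4;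
    above it the penalty alone exceeds c. *)
Lemma tau_hat2_lower n p (X : 'M[R]_(n, p.+1)) (g : 'cV[R]_p) K Cmin Cmax :
  (0 < n)%N -> (0 < K)%N -> (K %| n)%N -> (1 < n %/ K)%N -> (n < p.+1)%N ->
  0 < Cmin -> 0 < Cmax ->
  Cmin <= phi_min X (n %/ K) -> phi_max X n <= Cmax ->
  Num.min (Cmin / 4) (Num.sqrt Cmin / (6 * Num.sqrt Cmax * Num.sqrt K%:R))
  <= tau_hat2 X (Num.sqrt n%:R)^-1 g.
Proof.
move=> n0 K0 Kn m1 np Cmin0 Cmax0 hmin hmax.
have H := nodewise_residual_lower g n0 m1 (leq_div n K) np (ltW Cmin0) (ltW Cmax0) hmin hmax.
move: H; set L := l1norm g; set c := _ / (6 * _ * _).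
have nR0 : 0 < n%:R :> R by rewrite ltr0n.
have sn0 : 0 < Num.sqrt n%:R :> R by rewrite sqrtr_gt0.
have sm0 : 0 < Num.sqrt (n %/ K)%:R :> R by rewrite sqrtr_gt0 ltr0n ltnW.
have sK0 : 0 < Num.sqrt K%:R :> R by rewrite sqrtr_gt0 ltr0n.
have sC0 : 0 < Num.sqrt Cmax by rewrite sqrtr_gt0.
have sc0 : 0 < Num.sqrt Cmin by rewrite sqrtr_gt0.
have snE : Num.sqrt n%:R = Num.sqrt (n %/ K)%:R * Num.sqrt K%:R :> R.
  by rewrite -sqrtrM ?ler0n// -natrM divnK.
have L0 : 0 <= L := l1norm_ge0 _.
rewrite /tau_hat2 /tau_tilde2 -/L => H.
have [Lc|cL] := leP L (c * Num.sqrt n%:R); last first.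
  rewrite ge_min; apply/orP; right.
  rewrite (le_trans _ (_ : (Num.sqrt n%:R)^-1 * L <= _))//; last first.
    by rewrite lerDr divr_ge0// sqnorm_ge0.
  by rewrite mulrC ler_pdivlMr// ltW.
rewrite ge_min; apply/orP; left.
apply: (@le_trans _ _ (sqnorm (col ord0 X - col' ord0 X *m g) / n%:R)); last first.
  by rewrite lerDl mulr_ge0// invr_ge0 ltW.
have h : Num.sqrt Cmin * Num.sqrt n%:R / 2 <= norm2 (col ord0 X - col' ord0 X *m g).
  apply: le_trans H; rewrite lerBrDr -lerBrDl.
  rewrite (_ : _ - _ = Num.sqrt Cmin * Num.sqrt n%:R / 2); last by field.
  rewrite ler_pdivrMr// [in leLHS]mulrC.
  apply: (@le_trans _ _ (c * Num.sqrt n%:R * (3 * Num.sqrt Cmax * Num.sqrt n%:R))).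
    by rewrite ler_wpM2r// !mulr_ge0// ltW.
  rewrite snE /c le_eqVlt; apply/orP; left; apply/eqP.
  by field; rewrite !gt_eqF.
rewrite ler_pdivlMr// -sqr_norm2.
have : (Num.sqrt Cmin * Num.sqrt n%:R / 2) ^+ 2 <= norm2 (col ord0 X - col' ord0 X *m g) ^+ 2.
  by rewrite ler_sqr ?nnegrE ?norm2_ge0// ltW// !mulr_gt0// invr_gt0.
apply: le_trans; rewrite !exprMn !sqr_sqrtr ?(ltW Cmin0)// exprVn; lra.
Qed.

End nodewise_lower.

(** * The l1 error of the Lasso *)

Section lasso_error.
Context {R : realType}.

Lemma l1norm_restrict_sqr k (S : {set 'I_k}) (z : 'cV[R]_k) :
  l1norm (Defs.restrict S z) ^+ 2 <= #|S|%:R * sqnorm (Defs.restrict S z).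
Proof.
pose u : 'cV[R]_k := Defs.restrict S (const_mx 1).
pose v : 'cV[R]_k := \col_i `|Defs.restrict S z i 0|.
have -> : l1norm (Defs.restrict S z) = dot u v.
  by apply: eq_bigr => i _; rewrite !mxE; case: ifP; rewrite ?mul1r// normr0 mul0r.
apply: le_trans (dot_cauchy _ _) _.
have -> : sqnorm u = #|S|%:R.
  rewrite sqnorm_restrict -sum1_card natr_sum.
  by apply: eq_bigr => i _; rewrite mxE expr1n.
rewrite ler_wpM2l// le_eqVlt; apply/orP; left; apply/eqP.
by apply: eq_bigr => i _; rewrite [v i 0]mxE real_normK ?num_real.
Qed.

Lemma kappa2_sqnorm n p (X : 'M[R]_(n, p)) s c0 k2 (S : {set 'I_p}) (z : 'cV[R]_p) :
  0 < k2 -> k2 <= kappa2 X s c0 -> (#|S| <= s)%N -> z != 0 ->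
  l1norm (Defs.restrict (~: S)%SET z) <= c0 * l1norm (Defs.restrict S z) ->
  k2 * sqnorm (Defs.restrict S z) <= sqnorm (X *m z) / n%:R.
Proof.
move=> k0 hk Ss z0 cone; set q := sqnorm (Defs.restrict S z).
have : k2 <= sqnorm (X *m z) / (n%:R * q).
  apply: le_trans hk _; apply: ge_inf; last by exists S, z.
  by exists 0 => _ [S' [z' [_ _ _ ->]]]; rewrite divr_ge0 ?mulr_ge0 ?sqnorm_ge0.
have [->|q0] := eqVneq q 0; first by move=> _; rewrite mulr0 divr_ge0 ?sqnorm_ge0.
have qp : 0 < q by rewrite lt_def q0 sqnorm_ge0.
by rewrite invfM mulrA ler_pdivlMr.
Qed.

(** With a and a' the l1 errors on and off the support and Q the prediction error, Q + lam a' <= 3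
    lam a gives the cone condition, hence k2 a^2 <= s0 Q. Then lam (a + a') <= 4 lam a - Q, whose
    maximum under that constraint is 4 lam^2 s0 / k2. *)
Lemma lasso_l1_error n p (X : 'M[R]_(n, p)) (b0 b : 'cV[R]_p) (e : 'cV[R]_n) lam k2 :
  (0 < n)%N -> 0 < lam -> 0 < k2 ->
  is_lasso_min X (X *m b0 + e) lam b ->
  (forall j, `|dot (col j X) e| <= n%:R * lam / 2) ->
  k2 <= kappa2 X (l0norm b0) 3 ->
  l1norm (b0 - b) <= 4 * lam * (l0norm b0)%:R / k2.
Proof.
move=> n0 lam0 k0 bmin noise hk.
have nR0 : 0 < n%:R :> R by rewrite ltr0n.
pose D := b - b0; pose S : {set 'I_p} := [set i | b0 i 0 != 0]%SET.
have cS : #|S| = l0norm b0 by rewrite l0normE.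
have -> : l1norm (b0 - b) = l1norm D.
  by rewrite -opprB -scaleN1r l1normZ normrN1 mul1r.
set s0 : R := (l0norm b0)%:R; have s00 : 0 <= s0 by [].
have [->|D0] := eqVneq D 0.
  have -> : l1norm (0 : 'cV[R]_p) = 0.
    by rewrite /l1norm big1// => i _; rewrite mxE normr0.
  by rewrite divr_ge0 ?mulr_ge0// ltW.
pose Q := sqnorm (X *m D) / n%:R.
pose a := l1norm (Defs.restrict S D); pose a' := l1norm (Defs.restrict (~: S)%SET D).
have Q0 : 0 <= Q by rewrite divr_ge0 ?sqnorm_ge0.
have a0 : 0 <= a := l1norm_ge0 _.
have lD : l1norm D = a + a' by exact: l1norm_restrictD.
(* On the support this is the triangle inequality; off it [b0] vanishes, so b and the error
   coincide. *)
have l1b : l1norm b0 - a + a' <= l1norm b.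
  rewrite [l1norm b](l1norm_restrictD S) lerD//.
    rewrite lerBlDr.
    have -> : l1norm b0 = l1norm (Defs.restrict S b0).
      apply: eq_bigr => i _; rewrite mxE; case: ifPn => //.
      by rewrite inE negbK => /eqP ->.
    have -> : Defs.restrict S b0 = Defs.restrict S b + Defs.restrict S (- D).
      by apply/colP => i; rewrite !mxE; case: ifP => _; rewrite ?addr0// opprB addrC subrK.
    apply: le_trans (l1normD _ _) _; rewrite lerD2l le_eqVlt; apply/orP; left; apply/eqP.
    by apply: eq_bigr => i _; rewrite !mxE; case: ifP => // _; rewrite normrN.
  rewrite le_eqVlt; apply/orP; left; apply/eqP; congr l1norm.
  apply/colP => i; rewrite !mxE !inE; case: ifP => //.
  by rewrite negbK => /eqP ->; rewrite subr0.
have dXe : dot (X *m D) e <= n%:R * lam / 2 * l1norm D.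
  rewrite dot_mulmx dotC; apply: le_trans (ler_norm _) _.
  apply: dot_le_l1norm => j; rewrite (_ : (X^T *m e) j 0 = dot (col j X) e)//.
  by rewrite mxE; apply: eq_bigr => i _; rewrite !mxE.
have basic : Q + 2 * lam * l1norm b <= 2 * dot (X *m D) e / n%:R + 2 * lam * l1norm b0.
  have := bmin b0; rewrite /lasso_obj.
  have -> : X *m b0 + e - X *m b = e - 1 *: (X *m D).
    by rewrite scale1r mulmxBr opprB addrCA addrA.
  have -> : X *m b0 + e - X *m b0 = e by rewrite addrC addKr.
  by rewrite sqnormBZ /Q expr1n mulr1 mul1r !mulrDl mulNr; lra.
(* The noise costs at most lam (a + a') and the penalties differ by at most 2 lam (a - a'). *)
have key : Q + lam * a' <= 3 * lam * a.
  have : 2 * dot (X *m D) e / n%:R <= lam * (a + a').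
    by rewrite ler_pdivrMr// -lD; lra.
  have : 2 * lam * (l1norm b0 - a + a') <= 2 * lam * l1norm b.
    by rewrite ler_wpM2l// mulr_ge0// ltW.
  by move: basic; lra.
have cone : a' <= 3 * a.
  by rewrite -(ler_pM2l lam0); move: key; lra.
have kS := kappa2_sqnorm k0 hk (eq_leq cS) D0 cone.
have aS : a ^+ 2 <= s0 * sqnorm (Defs.restrict S D).
  by rewrite /s0 -cS l1norm_restrict_sqr.
rewrite lD ler_pdivlMr//.
have kQ : k2 * a ^+ 2 <= s0 * Q.
  apply: (@le_trans _ _ (s0 * (k2 * sqnorm (Defs.restrict S D)))); last by rewrite ler_wpM2l.
  by rewrite [leRHS]mulrCA ler_wpM2l// ltW.
(* Treated apart because the main case multiplies through by s0; here a = 0 and the cone gives a' =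
   0. *)
have [s0z|sp] := eqVneq s0 0.
  move: kQ; rewrite s0z mul0r mulr0 pmulr_rle0// => a2.
  have /eqP : a ^+ 2 == 0 by rewrite eq_le a2 sqr_ge0.
  move/eqP; rewrite sqrf_eq0 => /eqP az; rewrite az in cone *.
  have a'0 : a' <= 0 by rewrite mulr0 in cone.
  by rewrite add0r mulr_le0_ge0// ltW.
have s0p : 0 < s0 by rewrite lt_def sp.
(* multiply by [lam * s0] and complete the square in [k2 a - 2 lam s0] *)
rewrite -(ler_pM2l (mulr_gt0 lam0 s0p)).
have sq : 0 <= (k2 * a - 2 * lam * s0) ^+ 2 := sqr_ge0 _.
have h1 : k2 * s0 * (lam * (a + a')) <= k2 * s0 * (4 * lam * a - Q).
  by rewrite ler_wpM2l ?mulr_ge0 ?(ltW k0)//; move: key; lra.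
have h2 : k2 * (k2 * a ^+ 2) <= k2 * (s0 * Q) by rewrite ler_wpM2l// ltW.
have -> : lam * s0 * ((a + a') * k2) = k2 * s0 * (lam * (a + a')) by ring.
apply: le_trans h1 _; move: sq h2; rewrite sqrrB !exprMn; lra.
Qed.

End lasso_error.

(** * Events of probability tending to one *)

Section with_high_probability.
Context {R : realType} {d : measure_display} {T : nat -> measurableType d}.
Context (P : forall m, probability (T m) R).

Lemma fine_probability_le1 m (A : set (T m)) : measurable A -> fine (P m A) <= 1.
Proof.
by move=> mA; rewrite -lee_fin fineK ?fin_num_measure// probability_le1.
Qed.

Lemma wp1_ge (B : forall m, set (T m)) (e : nat -> R) :
  (forall m, measurable (B m)) -> e @ \oo --> (0 : R) ->
  (\forall m \near \oo, 1 - e m <= fine (P m (B m))) -> wp1 P B.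
Proof.
move=> mB e0 eB; exists B; split; first by move=> m; split.
have e1 : (fun m => 1 - e m) @ \oo --> (1 : R).
  by rewrite -[X in _ --> X]subr0; apply: cvgB => //; exact: cvg_cst.
apply: (squeeze_cvgr _ e1 (cvg_cst (1 : R))); apply: filterS eB => m ->/=.
exact: fine_probability_le1.
Qed.

(** [wp1] wants a subevent for every m while the inclusion holds only eventually; the empty event
    fills in elsewhere and leaves the limit unchanged. *)
Lemma wp1S (A A' : forall m, set (T m)) :
  (\forall m \near \oo, A m `<=` A' m) -> wp1 P A -> wp1 P A'.
Proof.
move=> AA' [B [mB B1]].
exists (fun m => if `[< A m `<=` A' m >] then B m else set0); split => [m|].
  case: asboolP => AA'm; last by split.
  have [mBm BA] := mB m; split => //; exact: subset_trans BA AA'm.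
apply/cvgrPdist_le => e e0; move/cvgrPdist_le : B1 => /(_ e e0).
by apply: filterS2 AA' => m AA'm; rewrite asboolT.
Qed.

Lemma wp1I (A A' : forall m, set (T m)) :
  wp1 P A -> wp1 P A' -> wp1 P (fun m => A m `&` A' m).
Proof.
move=> [B [mB B1]] [B' [mB' B'1]].
apply: (@wp1S (fun m => B m `&` B' m)).
  by near=> m; apply: setISS; [have [] := mB m|have [] := mB' m].
apply: (@wp1_ge _ (fun m => (1 - fine (P m (B m))) + (1 - fine (P m (B' m))))).
- by move=> m; apply: measurableI; [have [] := mB m|have [] := mB' m].
- rewrite -[X in _ --> X](addr0 0) -{1}[0](subrr 1) -[X in _ + X](subrr 1).
  by apply: cvgD; apply: cvgB => //; exact: cvg_cst.
near=> m; have [mBm _] := mB m; have [mBm' _] := mB' m.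
have mI : measurable (B m `&` B' m) by exact: measurableI.
have : (P m (~` (B m `&` B' m)) <= P m (~` B m) + P m (~` B' m))%E.
  by rewrite setCI; apply: measureU2; exact: measurableC.
rewrite !probability_setC//.
rewrite -(@fineK _ (P m (B m `&` B' m))) ?fin_num_measure//.
rewrite -(@fineK _ (P m (B m))) ?fin_num_measure//.
rewrite -(@fineK _ (P m (B' m))) ?fin_num_measure//.
by rewrite -!EFinB -EFinD lee_fin; lra.
Unshelve. all: by end_near. Qed.

Lemma wp1_OP1 (Z : forall m, T m -> R) M :
  wp1 P (fun m => [set w | `|Z m w| <= M]) -> OP1 P Z.
Proof.
move=> [B [mB B1]] eta eta0; exists M.
move/cvgrPdist_le : B1 => /(_ eta eta0); apply: filterS => m h.
exists (B m); have [mBm BZ] := mB m; split => //.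
by have := le_trans (ler_norm _) h; lra.
Qed.

Lemma prob_O_inv_wp1 (A : forall m, set (T m)) (p : nat -> nat) :
  (fun m => (p m)%:R^-1) @ \oo --> (0 : R) -> prob_O_inv P A p ->
  wp1 P (fun m => ~` A m).
Proof.
move=> p0 [c [M _ HM]].
(* The covering events exist only from M on; below M the empty set makes the choice total. *)
have H m : exists B : set (T m), measurable B /\
    ((M <= m)%N -> A m `<=` B /\ fine (P m B) <= c / (p m)%:R).
  have [Mm|_] := leqP M m; last by exists set0; split.
  by have [B [mB AB PB]] := HM m Mm; exists B; split.
pose B m := projT1 (cid (H m)).
have HB m : measurable (B m) /\
    ((M <= m)%N -> A m `<=` B m /\ fine (P m (B m)) <= c / (p m)%:R).
  exact: projT2 (cid (H m)).
apply: (@wp1S (fun m => ~` B m)).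
  by exists M => // m /= Mm; apply: subsetC; have [_ /(_ Mm)[]] := HB m.
apply: (@wp1_ge _ (fun m => c / (p m)%:R)).
- by move=> m; apply: measurableC; have [] := HB m.
- by rewrite -[X in _ --> X](mulr0 c); apply: cvgMl_tmp.
exists M => // m /= Mm; have [mB /(_ Mm)[_ PB]] := HB m.
rewrite probability_setC// -(@fineK _ (P m (B m))) ?fin_num_measure//.
by rewrite -EFinB/= lerD2l lerN2.
Qed.

End with_high_probability.

(** * Maximal correlation between noise and columns *)

Section noise.
Context {R : realType}.

Lemma gauss_law_tail (v V u : R) : 0 < V -> v <= V -> 0 <= u ->
  (gauss_law v [set x | (u < `|x|)%R] <= (2 * expR (- u ^+ 2 / (V *+ 2)))%:E)%E.
Proof.
move=> V0 vV u0; rewrite /gauss_law; case: (leP v 0) => v0.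
  rewrite diracE memNset/= ?normr0 -?leNgt//; last by apply/negP; rewrite -leNgt.
  by rewrite lee_fin mulr_ge0// expR_ge0.
apply: (le_trans (normal_prob_tail _ _)) => //; first by rewrite sqrtr_gt0.
rewrite lee_fin ler_pM2l// ler_expR sqr_sqrtr ?(ltW v0)// !mulNr lerN2.
rewrite ler_wpM2l ?sqr_ge0// lef_pV2 ?posrE ?pmulrn_lgt0//.
by rewrite lerMn2r.
Qed.

(** The law is that of sqrt v times a fixed standard Gaussian, so its value at B is the measure of a
    section of a measurable set in the plane. Negative v agree with the Dirac branch because
    [Num.sqrt] sends them to 0. *)
Lemma measurable_gauss_law (B : set R) : measurable B ->
  measurable_fun setT (fun v : R => gauss_law v B).
Proof.
move=> mB; pose RR := measurableTypeR R; pose N : probability RR R := normal_prob 0 1.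
have mphi : measurable_fun setT (fun z : RR * RR => (Num.sqrt z.1 * z.2 : RR)).
  apply: (measurable_funM (R := R)) => //.
  exact: (measurableT_comp (continuous_measurable_fun (@sqrt_continuous R))).
have mK : measurable [set z : RR * RR | B (Num.sqrt z.1 * z.2)].
  by rewrite -[X in measurable X]setTI; exact: mphi.
rewrite (_ : (fun v => _) = N \o xsection [set z : RR * RR | B (Num.sqrt z.1 * z.2)]).
  exact: measurable_fun_xsection.
apply/funext => v /=; transitivity (N [set z | B (Num.sqrt v * z)]); last first.
  by congr (N _); apply/seteqP; split => z; rewrite /xsection/= inE.
rewrite [RHS](esym (gauss_lawE ltr01 (sqrtr_ge0 v) mB)) expr1n mul1r.
have [v0|v0] := leP 0 v; first by rewrite sqr_sqrtr.
rewrite (ler0_sqrtr (ltW v0)) expr0n /gauss_law lexx (ltW v0).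
reflexivity.
Qed.

Context d (T : measurableType d) (P : probability T R) n p
  (X : T -> 'M[R]_(n, p)) (eps : T -> 'cV[R]_n) (sigma : R).
Hypothesis mX : forall i j, measurable_fun setT (fun w => X w i j).
Hypothesis meps : forall i, measurable_fun setT (fun w => eps w i 0).
Hypothesis gauss : gaussian_noise_indep P X eps sigma.
Hypothesis sigma0 : 0 < sigma.

(** The column bound is part of the event, so the conditional variance is controlled on it; the
    bound itself comes later from [phi_max] at 1. *)
Definition loud_noise (V u : R) (j : 'I_p) : set T :=
  [set w | sqnorm (col j (X w)) <= V] `&` [set w | u < `|dot (col j (X w)) (eps w)|].

Let abs_tail (u : R) : measurable [set x : R | u < `|x|].
Proof.
rewrite -[X in measurable X]setTI.
have := @normr_measurable R setT measurableT `]u, +oo[%classic (measurable_itv _).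
by congr measurable; apply/seteqP; split => x /=; rewrite in_itv/= andbT.
Qed.

Lemma measurable_loud_noise V u j : measurable (loud_noise V u j).
Proof.
apply: measurableI.
  have mf : measurable_fun setT (fun w => sqnorm (col j (X w))).
    apply: measurable_sum => i; apply: measurable_funX.
    by under eq_fun do rewrite mxE; exact: mX.
  rewrite -[X in measurable X]setTI.
  have := mf measurableT `]-oo, V]%classic (measurable_itv _).
  by congr measurable; apply/seteqP; split => x /=; rewrite in_itv.
have mf : measurable_fun setT (fun w => dot (col j (X w)) (eps w)).
  apply: measurable_sum => i; apply: measurable_funM => //.
  by under eq_fun do rewrite mxE; exact: mX.
by rewrite -[X in measurable X]setTI; exact: (mf measurableT _ (abs_tail u)).
Qed.

(** Given the design, X_j^T eps is centred Gaussian with variance at most sigma^2 V on the column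
    event; its tail bound is integrated over that sigma(X)-event. *)
Lemma loud_noise_le V u j : 0 < V -> 0 <= u ->
  (P (loud_noise V u j) <= (2 * expR (- u ^+ 2 / ((sigma ^+ 2 * V) *+ 2)))%:E)%E.
Proof.
move=> V0 u0; pose G := design_rect X.
have ma i : measurable_fun setT (fun w : g_sigma_algebraType G => X w i j).
  exact: measurable_design_entry.
have mE : measurable ([set w | sqnorm (col j (X w)) <= V] : set (g_sigma_algebraType G)).
  have mf : measurable_fun setT (fun w : g_sigma_algebraType G => \sum_i X w i j ^+ 2).
    by apply: measurable_sum => i; exact: measurable_funX.
  have := mf measurableT `]-oo, V]%classic (measurable_itv _).
  rewrite setTI; congr measurable; apply/funext => w; apply/propext.
  rewrite /= in_itv/= /sqnorm.
  by under [in X in _ <-> X]eq_bigr do rewrite mxE.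
have := cond_gaussian_design mX meps gauss sigma0 ma mE (abs_tail u).
have -> : [set w | sqnorm (col j (X w)) <= V] `&`
    [set w | [set x : R | u < `|x|] (\sum_i X w i j * eps w i 0)] = loud_noise V u j.
  congr (_ `&` _); apply/funext => w; rewrite /dot/=.
  by under [in X in _ = X]eq_bigr do rewrite mxE.
move=> ->; set c := (_)%:E; set E := [set w | _].
apply: (@le_trans _ _ (\int[P]_(w in (E : set T)) cst c w)%E).
  apply: ge0_le_integral => //=.
  - exact: (design_rect_sigma_measurable mX mE).
  - by move=> w _; rewrite /gauss_law; case: ifP => _; exact: measure_ge0.
  - apply: measurable_funTS.
    apply: (measurableT_comp (measurable_gauss_law (abs_tail u))).
    apply: measurable_funM => //; apply: measurable_sum => i.
    exact: measurable_funX.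
  move=> w wV; apply: gauss_law_tail => //; first by rewrite mulr_gt0// exprn_gt0.
  rewrite ler_wpM2l ?sqr_ge0//; apply: le_trans wV.
  by apply/ler_sum => i _; rewrite mxE.
rewrite integral_cst//=; last exact: (design_rect_sigma_measurable mX mE).
rewrite -[leRHS]mule1; apply: lee_wpmul2l; last first.
  by apply: probability_le1; exact: (design_rect_sigma_measurable mX mE).
by rewrite lee_fin mulr_ge0// expR_ge0.
Qed.

Lemma quiet_probability V u : 0 < V -> 0 <= u ->
  1 - p%:R * (2 * expR (- u ^+ 2 / ((sigma ^+ 2 * V) *+ 2))) <=
  fine (P (~` \bigcup_(j in [set: 'I_p]) loud_noise V u j)).
Proof.
move=> V0 u0; set q := 2 * _.
have mU : measurable (\bigcup_(j in [set: 'I_p]) loud_noise V u j).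
  by apply: fin_bigcup_measurable => // j _; exact: measurable_loud_noise.
rewrite probability_setC// -(@fineK _ (P (\bigcup_(j in _) _))) ?fin_num_measure//.
rewrite -EFinB/= lerD2l lerN2 -lee_fin fineK ?fin_num_measure//.
apply: (@le_trans _ _ (\sum_(j \in [set: 'I_p]) P (loud_noise V u j))%E).
  apply: content_sub_fsum => //; first exact: finite_finset.
  by move=> j _; exact: measurable_loud_noise.
have -> : [set: 'I_p] = [set` index_enum 'I_p].
  by apply/seteqP; split => // j _ /=; rewrite mem_index_enum.
rewrite -fsbig_seq ?index_enum_uniq//; apply: (@le_trans _ _ (\sum_(j < p) q%:E)%E).
  by apply: lee_sum => j _; exact: loud_noise_le.
by rewrite sumEFin sumr_const card_ord lee_fin mulr_natl.
Qed.

End noise.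

(** * The debiased estimator *)

Section debiased.
Context {R : realType}.

Lemma debiased_decomposition n p (X : 'M[R]_(n, p.+1)) (Th b0 b : 'cV[R]_p.+1)
    (e : 'cV[R]_n) : (0 < n)%N ->
  Num.sqrt n%:R * (b_hat1 X (X *m b0 + e) Th b - b0 ord0 0) =
  (Num.sqrt n%:R)^-1 * ((Th^T *m X^T *m e) 0 0) +
  Num.sqrt n%:R * (((Sigma_hat X *m Th - e1 R p)^T *m (b0 - b)) 0 0).
Proof.
move=> n0; have nR0 : 0 < n%:R :> R by rewrite ltr0n.
have sn0 : 0 < Num.sqrt n%:R :> R by rewrite sqrtr_gt0.
have nE : (n%:R : R) = Num.sqrt n%:R ^+ 2 by rewrite sqr_sqrtr// ltW.
have res : X *m b0 + e - X *m b = X *m (b0 - b) + e.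
  by rewrite mulmxBr addrAC.
have e1E : ((e1 R p)^T *m (b0 - b)) 0 0 = b0 ord0 0 - b ord0 0.
  by rewrite /e1 trmx_delta -rowE !mxE.
have tB (A B : 'cV[R]_p.+1) : (A - B)^T = A^T - B^T by rewrite linearB.
rewrite /b_hat1 res mulmxDr tB mulmxBl.
have -> : (Sigma_hat X *m Th)^T *m (b0 - b) =
    n%:R^-1 *: (Th^T *m X^T *m (X *m (b0 - b))).
  by rewrite /Sigma_hat -scalemxAl linearZ/= -scalemxAl !trmx_mul trmxK !mulmxA.
have mxB (A B : 'M[R]_1) : (A - B) 0 0 = A 0 0 - B 0 0 by rewrite !mxE.
have mxD (A B : 'M[R]_1) : (A + B) 0 0 = A 0 0 + B 0 0 by rewrite mxE.
have mxZ a (A : 'M[R]_1) : (a *: A) 0 0 = a * A 0 0 by rewrite mxE.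
rewrite mxB mxD mxZ e1E.
set q := (_ *m (X *m _)) 0 0; set s := (_ *m e) 0 0.
have -> : (Num.sqrt n%:R)^-1 = Num.sqrt n%:R * n%:R^-1 :> R.
  by rewrite [in X in _ * X^-1]nE expr2 invfM mulrA divff ?mul1r ?gt_eqF.
ring.
Qed.

Lemma debiased_remainder n p (X : 'M[R]_(n, p.+1)) lam (g : 'cV[R]_p)
    (b0 b : 'cV[R]_p.+1) t0 : (0 < n)%N -> 0 <= lam ->
  is_nodewise_min X lam g -> 0 < t0 -> t0 <= tau_hat2 X lam g ->
  `|((Sigma_hat X *m Theta1 X lam g - e1 R p)^T *m (b0 - b)) 0 0| <=
  lam / t0 * l1norm (b0 - b).
Proof.
move=> n0 lam0 gmin t00 t0t; rewrite dotE; apply: dot_le_l1norm => j.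
have tp : 0 < tau_hat2 X lam g by exact: lt_le_trans t0t.
apply: le_trans (Sigma_hat_Theta1_bound n0 lam0 gmin tp j) _.
by rewrite ler_wpM2l// lef_pV2.
Qed.

(** Inverse as the power -1; both conventions give 0 at 0. *)
Lemma measurable_inv_ge0 d (T : measurableType d) (f : T -> R) :
  (forall w, 0 <= f w) -> measurable_fun setT f ->
  measurable_fun setT (fun w => (f w)^-1).
Proof.
move=> f0 mf; rewrite (_ : (fun w => _) = fun w => f w `^ (-1)); last first.
  by apply/funext => w; rewrite powR_inv1.
exact: measurableT_comp (measurable_powR (-1)) mf.
Qed.

(* The selected minimizer [g] need not be a Borel function of [X], but [X Theta]
   only involves the residual, which is. *)
Lemma cond_gauss_nodewise d (T : measurableType d) (P : probability T R) n p
    (X : T -> 'M[R]_(n, p.+1)) (eps : T -> 'cV[R]_n) sigma lam (g : T -> 'cV[R]_p) :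
  (0 < n)%N -> 0 <= lam -> 0 < sigma ->
  (forall i j, measurable_fun setT (fun w => X w i j)) ->
  (forall i, measurable_fun setT (fun w => eps w i 0)) ->
  gaussian_noise_indep P X eps sigma ->
  (forall w, is_nodewise_min (X w) lam (g w)) ->
  let Th w := Theta1 (X w) lam (g w) in
  cond_gauss P X
    (fun w => (Num.sqrt n%:R)^-1 * (((Th w)^T *m (X w)^T *m eps w) 0 0))
    (fun w => sigma ^+ 2 * (((Th w)^T *m Sigma_hat (X w) *m Th w) 0 0)).
Proof.
move=> n0 lam0 sg0 mX meps gauss gmin Th A B mA mB.
have nR0 : 0 < n%:R :> R by rewrite ltr0n.
pose r w : 'cV[R]_n := col ord0 (X w) - col' ord0 (X w) *m g w.
pose tau w := tau_hat2 (X w) lam (g w).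
pose a i w := (Num.sqrt n%:R)^-1 * ((tau w)^-1 * r w i 0).
pose TX := g_sigma_algebraType (design_rect X).
have mr i : measurable_fun setT (fun w : TX => r w i 0).
  apply: (@measurable_lasso_residual _ _ _ _ _ _ _ lam) => //.
  - by move=> k l; under eq_fun do rewrite mxE; exact: measurable_design_entry.
  - by move=> k; under eq_fun do rewrite mxE; exact: measurable_design_entry.
(* The definition of tau^2 involves |gamma|_1, not known to be sigma(X)-measurable; X_1^T r / n is
   the same number. *)
have mtau : measurable_fun setT (fun w : TX => tau w).
  rewrite (_ : (fun w : TX => tau w) =
      fun w : TX => n%:R^-1 * \sum_i X w i ord0 * r w i 0); last first.
    apply/funext => w.
    have <- : dot (col ord0 (X w)) (r w) = \sum_i X w i ord0 * r w i 0.
      by apply: eq_bigr => i _; rewrite mxE.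
    by rewrite (tau_hat2E n0 lam0 (gmin w)) mulKf// gt_eqF.
  apply: measurable_funM => //; apply: measurable_sum => i.
  by apply: measurable_funM => //; exact: measurable_design_entry.
have tau0 w : 0 <= tau w.
  rewrite /tau /tau_hat2 /tau_tilde2 addr_ge0 ?mulr_ge0 ?invr_ge0 ?sqnorm_ge0 ?l1norm_ge0//.
have ma i : measurable_fun setT (fun w : TX => a i w).
  apply: measurable_funM => //; apply: measurable_funM => //.
  exact: measurable_inv_ge0.
have XTh w : X w *m Th w = (tau w)^-1 *: r w by exact: mulmx_Theta1.
have mE : measurable (Xevent X A : set TX).
  by apply: sub_sigma_algebra; exists A.
have := cond_gaussian_design mX meps gauss sg0 ma mE mB.
have -> : (fun w => (Num.sqrt n%:R)^-1 * (((Th w)^T *m (X w)^T *m eps w) 0 0)) @^-1` B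
    = [set w | B (\sum_i a i w * eps w i 0)].
  apply/funext => w /=; congr B.
  rewrite -trmx_mul dotE XTh dotZl /dot !mulr_sumr; apply: eq_bigr => i _.
  by rewrite /a !mulrA.
move=> ->; apply: eq_integral => w _; congr (gauss_law _ B); congr (_ * _).
rewrite quad_Sigma_hat XTh sqnormZ /sqnorm !mulr_sumr mulr_suml.
apply: eq_bigr => i _; rewrite /a !exprMn [(_^-1) ^+ 2 in LHS]exprVn sqr_sqrtr ?ltW//.
by rewrite [RHS]mulrC mulrA.
Qed.

End debiased.

(** * The penalty level and the final assembly *)

Lemma col_sqnorm_le (R : realType) n p (X : 'M[R]_(n, p)) c j : (0 < n)%N ->
  phi_max X 1 <= c -> sqnorm (col j X) <= n%:R * c.
Proof.
move=> n0 hX; rewrite colE mulrC -[n%:R]mulr1.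
have sq1 : sqnorm (delta_mx j 0 : 'cV[R]_p) = 1.
  rewrite /sqnorm (bigD1 j)//= big1 ?addr0 => [|i ij]; rewrite mxE ?eqxx ?expr1n//.
  by rewrite (negbTE ij) expr0n.
rewrite -[X in n%:R * X]sq1; apply: (phi_max_sqnorm n0 hX).
rewrite l0normE (_ : [set i | _]%SET = [set j]%SET) ?cards1//.
apply/setP => i; rewrite !inE mxE andbT.
by case: (i == j); rewrite ?oner_eq0 ?eqxx.
Qed.

(** The factor 4 sigma sqrt C in lambda_0 makes the exponent -2 log p, so the union bound over p
    columns leaves 2 / p. *)
Lemma noise_level (R : realType) (sigma C : R) (n p : nat) :
  0 < sigma -> 0 < C -> (0 < n)%N -> (1 < p)%N ->
  p%:R * (2 * expR (- (n%:R * (4 * sigma * Num.sqrt C * Num.sqrt (ln p%:R / n%:R)) / 2) ^+ 2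
    / ((sigma ^+ 2 * (n%:R * C)) *+ 2))) = 2 * p%:R^-1.
Proof.
move=> sg0 C0 n0 p1; have nR0 : 0 < n%:R :> R by rewrite ltr0n.
have pR0 : 0 < p%:R :> R by rewrite ltr0n ltnW.
have lp0 : 0 < ln p%:R :> R by rewrite ln_gt0// ltr1n.
have -> : - (n%:R * (4 * sigma * Num.sqrt C * Num.sqrt (ln p%:R / n%:R)) / 2) ^+ 2
    / ((sigma ^+ 2 * (n%:R * C)) *+ 2) = - (ln p%:R + ln p%:R) :> R.
  rewrite !exprMn !sqr_sqrtr ?divr_ge0 ?(ltW C0) ?(ltW lp0)//.
  by field; rewrite !gt_eqF.
rewrite expRN expRD lnK ?posrE//; field; exact: lt0r_neq0.
Qed.

(* Regime indexed by m -> oo; sample size n m, dimension p_m = (pp m).+1. *)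
Theorem theorem1 (R : realType) (d : measure_display)
  (T : nat -> measurableType d) (P : forall m, probability (T m) R)
  (n pp : nat -> nat)
  (X : forall m, T m -> 'M[R]_(n m, (pp m).+1))
  (eps : forall m, T m -> 'cV[R]_(n m))
  (beta0 : forall m, 'cV[R]_((pp m).+1))
  (sigma Cmin Cmax Cstar kmin : R) (K : nat) :
  (* regime *)
  (forall m, (0 < n m)%N) ->
  (forall N, exists M, forall m, (M <= m)%N -> (N <= n m)%N) ->
  (forall m, (n m < (pp m).+1)%N) ->
  (* random design: measurable entries, zero mean, Sigma = E[X^T X / n] p.d. *)
  (forall m i j, measurable_fun setT (fun w => X m w i j)) ->
  (forall m i j, (P m).-integrable setT (fun w => (X m w i j)%:E)) ->
  (forall m i j, (\int[P m]_w (X m w i j)%:E = 0)%E) ->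
  (forall m j k, (P m).-integrable setT
      (fun w => (((X m w)^T *m X m w) j k / (n m)%:R)%:E)) ->
  (forall m (z : 'cV[R]_((pp m).+1)), z != 0 ->
     0 < (z^T *m (\matrix_(j, k) fine (\int[P m]_w
             (((X m w)^T *m X m w) j k / (n m)%:R)%:E)) *m z) 0 0) ->
  (* noise: eps ~ N(0, sigma^2 I_n) independent of X *)
  0 < sigma ->
  (forall m i, measurable_fun setT (fun w => eps m w i 0)) ->
  (forall m, gaussian_noise_indep (P m) (X m) (eps m) sigma) ->
  (* (A1) *)
  (forall m, {ae P m, forall w, general_position (X m w)}) ->
  (* (A2) *)
  0 < Cmin -> (0 < K)%N -> (forall m, (K %| n m)%N) ->
  wp1 P (fun m => [set w | Cmin <= phi_min (X m w) (n m %/ K)]) ->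
  (* (A3) *)
  0 < Cmax ->
  wp1 P (fun m => [set w | phi_max (X m w) (n m) <= Cmax]) ->
  (* (A4) *)
  0 < Cstar ->
  prob_O_inv P (fun m => [set w | Cstar < phi_max (X m w) 1])
             (fun m => (pp m).+1) ->
  0 < kmin ->
  wp1 P (fun m => [set w | kmin ^+ 2 <= kappa2 (X m w) (l0norm (beta0 m)) 3]) ->
  (* sparsity s0 = o(sqrt(n / log p)) *)
  (fun m => (l0norm (beta0 m))%:R /
              Num.sqrt ((n m)%:R / ln ((pp m).+1)%:R)) @ \oo --> (0 : R) ->
  exists lam0 lam1 : nat -> R,
    asymp lam0 (fun m => Num.sqrt (ln ((pp m).+1)%:R / (n m)%:R)) /\
    asymp lam1 (fun m => (Num.sqrt (n m)%:R)^-1) /\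
    forall (bsel : forall m, 'M[R]_(n m, (pp m).+1) -> 'cV[R]_(n m) ->
                              'cV[R]_((pp m).+1))
           (gsel : forall m, 'M[R]_(n m, (pp m).+1) -> 'cV[R]_(pp m)),
      (* bsel, gsel select Lasso / node-wise Lasso minimizers ... *)
      (forall m M Y, is_lasso_min M Y (lam0 m) (bsel m M Y)) ->
      (forall m M, is_nodewise_min M (lam1 m) (gsel m M)) ->
      (* ... and yield random variables *)
      (forall m j, measurable_fun setT
         (fun w => bsel m (X m w) (X m w *m beta0 m + eps m w) j 0)) ->
      (forall m j, measurable_fun setT (fun w => gsel m (X m w) j 0)) ->
      let Y m w := X m w *m beta0 m + eps m w in
      let bh m w := bsel m (X m w) (Y m w) in
      let Th m w := Theta1 (X m w) (lam1 m) (gsel m (X m w)) in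
      let W1 m w := (Num.sqrt (n m)%:R)^-1 *
                     (((Th m w)^T *m (X m w)^T *m eps m w) 0 0) in
      let Om m w := (((Th m w)^T *m Sigma_hat (X m w) *m Th m w) 0 0) in
      let D1 m w := Num.sqrt (n m)%:R *
         (((Sigma_hat (X m w) *m Th m w - e1 R (pp m))^T *m
            (beta0 m - bh m w)) 0 0) in
      (forall m w, Num.sqrt (n m)%:R *
          (b_hat1 (X m w) (Y m w) (Th m w) (bh m w) - beta0 m ord0 0)
        = W1 m w + D1 m w) /\
      (forall m, cond_gauss (P m) (X m) (W1 m) (fun w => sigma ^+ 2 * Om m w)) /\
      OP1 P Om /\
      oP1 P D1.
Proof.
move=> n0 noo np mX _ _ _ _ sg0 meps gauss _ Cmin0 K0 Kn wA2 Cmax0 wA3 Cst0 wA4 km0 wk sparse.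
have nR0 m : 0 < (n m)%:R :> R by rewrite ltr0n.
have p1 m : (1 < (pp m).+1)%N by exact: leq_ltn_trans (n0 m) (np m).
have lp0 m : 0 < ln ((pp m).+1)%:R :> R by rewrite ln_gt0// ltr1n.
have sn0 m : 0 < Num.sqrt (n m)%:R :> R by rewrite sqrtr_gt0.
have sl0 m : 0 < Num.sqrt (ln ((pp m).+1)%:R / (n m)%:R) :> R.
  by rewrite sqrtr_gt0 divr_gt0.
pose A : R := 4 * sigma * Num.sqrt Cstar.
have A0 : 0 < A by rewrite !mulr_gt0// sqrtr_gt0.
pose lam0 m : R := A * Num.sqrt (ln ((pp m).+1)%:R / (n m)%:R).
pose lam1 m : R := (Num.sqrt (n m)%:R)^-1.
have lam00 m : 0 < lam0 m by rewrite mulr_gt0.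
have lam10 m : 0 <= lam1 m by rewrite invr_ge0 ltW.
exists lam0, lam1; split; [|split].
- exists A, A; split => //; split => // m.
  by rewrite /lam0 mulfK ?lexx// gt_eqF.
- exists 1, 1; split => //; split => // m.
  by rewrite /lam1 divff ?lexx// invr_eq0 gt_eqF.
move=> bsel gsel bmin gmin _ _ Y bh Th W1 Om D1.
pose t0 : R := Num.min (Cmin / 4) (Num.sqrt Cmin / (6 * Num.sqrt Cmax * Num.sqrt K%:R)).
have t00 : 0 < t0.
  by rewrite lt_min !divr_gt0// ?mulr_gt0// sqrtr_gt0// ltr0n.
(* n >= 2 K gives n / K >= 2, so at least one slot is left beside the first coordinate. *)
have [M HM] := noo (2 * K)%N.
have tau_ge m w : (M <= m)%N -> Cmin <= phi_min (X m w) (n m %/ K) ->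
    phi_max (X m w) (n m) <= Cmax -> t0 <= tau_hat2 (X m w) (lam1 m) (gsel m (X m w)).
  move=> Mm h1 h2; apply: tau_hat2_lower => //.
  by rewrite leq_divRL// HM.
(* The dimension diverges because it exceeds n; this turns O(1/p) bounds into vanishing ones. *)
have pinv0 : (fun m => ((pp m).+1)%:R^-1 : R) @ \oo --> (0 : R).
  apply/cvgrPdist_le => e e0.
  have [N HN] := noo (Num.truncn e^-1).+1.
  exists N => // m /= Nm; rewrite sub0r normrN ger0_norm// -[e]invrK lef_pV2 ?posrE ?invr_gt0//.
  have e1 : e^-1 < (Num.truncn e^-1).+1%:R by apply: truncnS_gt.
  apply: (le_trans (ltW e1)); rewrite ler_nat.
  exact: leq_trans (HN m Nm) (ltnW (np m)).
split; first by move=> m w; exact: debiased_decomposition.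
split; first by move=> m; exact: cond_gauss_nodewise.
split.
  apply: (@wp1_OP1 _ _ _ _ _ t0^-1).
  apply: wp1S (wp1I wA2 wA3); exists M => // m /= Mm w [h1 h2] /=.
  have tt := tau_ge m w Mm h1 h2.
  have tp : 0 < tau_hat2 (X m w) (lam1 m) (gsel m (X m w)) by exact: lt_le_trans tt.
  rewrite ger0_norm; last by rewrite /Om quad_Sigma_hat divr_ge0// sqnorm_ge0.
  apply: le_trans (Omega_hat_le (lam10 m) tp) _.
  by rewrite lef_pV2.
move=> delta delta0.
pose V m : R := (n m)%:R * Cstar.
pose u m : R := (n m)%:R * lam0 m / 2.
have quiet : wp1 P (fun m => ~` \bigcup_(j in [set: 'I_(pp m).+1])
    loud_noise (X m) (eps m) (V m) (u m) j).
  apply: (@wp1_ge _ _ _ _ _ (fun m => 2 * ((pp m).+1)%:R^-1)).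
  - move=> m; apply: measurableC; apply: fin_bigcup_measurable.
      exact: finite_finset.
    by move=> j _; exact: measurable_loud_noise.
  - by rewrite -[X in _ --> X](mulr0 2); exact: cvgMl_tmp.
  exists 0%N => // m _; rewrite -(noise_level sg0 Cst0 (n0 m) (p1 m)).
  have u0 : 0 <= u m by apply: divr_ge0 => //; apply: mulr_ge0 => //; exact: ltW.
  exact: (quiet_probability (mX m) (meps m) (gauss m) sg0 (mulr_gt0 (nR0 m) Cst0) u0).
have bounded := prob_O_inv_wp1 pinv0 wA4.
apply: wp1S (wp1I (wp1I wA2 wA3) (wp1I wk (wp1I bounded quiet))).
(* On the good event |Delta_1| <= 4 A s_0 sqrt(log p / n) / (t0 kmin^2), which is at most delta once
   the sparsity ratio is at most c. *)
pose c : R := delta * t0 * kmin ^+ 2 / (4 * A).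
have k20 : 0 < kmin ^+ 2 := exprn_gt0 2 km0.
have c0 : 0 < c by apply: divr_gt0; apply: mulr_gt0 => //; exact: mulr_gt0.
move/cvgrPdist_le : sparse => /(_ c c0) [M' _ HM'].
exists (maxn M M') => // m /=; rewrite geq_max => /andP[Mm M'm] w.
move=> [[h1 h2] [hk [/negP h3 hq]]] /=; rewrite -leNgt in h3.
have tt := tau_ge m w Mm h1 h2.
have err : l1norm (beta0 m - bh m w) <=
    4 * lam0 m * (l0norm (beta0 m))%:R / kmin ^+ 2.
  apply: (lasso_l1_error (n0 m) (lam00 m) (exprn_gt0 _ km0) (bmin m _ _)) => // j.
  (* The bound on [phi_max] at 1 makes every column short, so a large correlation would put w in
     [loud_noise]. *)
  rewrite leNgt; apply/negP => loud; apply: hq; exists j => //; split => //=.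
  exact: col_sqnorm_le.
rewrite /D1 normrM (gtr0_norm (sn0 m)).
(* Here sqrt n and [lam1] cancel. *)
apply: le_trans (_ : Num.sqrt (n m)%:R * (lam1 m / t0 * l1norm (beta0 m - bh m w)) <= _).
  by rewrite ler_wpM2l ?(ltW (sn0 m))//; apply: debiased_remainder.
rewrite /lam1 !mulrA divff ?gt_eqF// mul1r ler_pdivrMl//.
apply: (le_trans err); rewrite ler_pdivrMr//.
have := HM' m M'm; rewrite sub0r normrN ger0_norm; last by rewrite divr_ge0// sqrtr_ge0.
have -> : Num.sqrt ((n m)%:R / ln ((pp m).+1)%:R) =
    (Num.sqrt (ln ((pp m).+1)%:R / (n m)%:R))^-1 :> R.
  by rewrite -sqrtrV ?divr_ge0 ?(ltW (lp0 m))// invf_div.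
have A4 : 0 < 4 * A by apply: mulr_gt0.
rewrite invrK /c ler_pdivlMr// => h.
by apply: le_trans (_ : _ <= delta * t0 * kmin ^+ 2) _; rewrite /lam0; lra.
Qed.
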